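(* For every $d\ge1$, the round sphere $S^d$, with its geodesic metric and uniform (normalised) area measure, admits thresholds.
   Context: For a metric probability space $\mathcal M=(M,d,\mu)$ and a configuration $\mathbf x=(x_1,\dots,x_n)\in M^n$, $r\ge0$, let $G_{\mathcal M}(\mathbf x,r)$ be the graph on $[n]$ in which $i\ne j$ are adjacent iff $d(x_i,x_j)\le r$; the random geometric graph $G_{\mathcal M}(n,r)$ is obtained by sampling $\mathbf x$ from $\mu^n$. A monotone graph property on $[n]$ is a family of graphs on vertex set $[n]$ closed under adding edges (not necessarily invariant under relabelling); it is nontrivial if it is neither empty nor all graphs. A sequence $r_n>0$ is a threshold for a sequence $(\mathcal F_n)$ of nontrivial monotone properties ($\mathcal F_n$ on $[n]$) if $\mathbb P(G_{\mathcal M}(n,s_n)\in\mathcal F_n)\to0$ whenever $s_n/r_n\to0$ and $\to1$ whenever $s_n/r_n\to\infty$. $\mathcal M$ admits thresholds if every sequence of nontrivial monotone properties has a threshold. *)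

(* Defs.v *)
From HB Require Import structures.
From mathcomp Require Import all_boot all_order all_algebra.
From mathcomp Require Import all_classical all_reals all_analysis.
From mathcomp Require Import ring lra.

Set Implicit Arguments.
Unset Strict Implicit.
Unset Printing Implicit Defensive.

Import Order.TTheory GRing.Theory Num.Theory.
Import numFieldNormedType.Exports.
Local Open Scope classical_set_scope.
Local Open Scope ring_scope.

(* The library requires measurable types to be pointed. *)
#[short(type="pointedMetricType")]
HB.structure Definition PointedMetric (R : numDomainType) :=
  { M of Metric R M & Pointed M }.

Section hausdorff.
Context {R : realType} {M : pointedMetricType R}.
Local Open Scope ereal_scope.
Implicit Types A B : set M.

(* diam set0 = -oo *)
Definition diam A : \bar R := ereal_sup [set (mdist x y)%:E | x in A & y in A].

(* The case distinction matters for k = 0, where 0 ^+ 0 = 1, and for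
   diam set0 = -oo. *)
Definition hausdorff_gauge (k : nat) A : \bar R :=
  if `[< A = set0 >] then 0 else diam A ^+ k.

Definition hausdorff_pre (k : nat) (delta : R) A : \bar R :=
  ereal_inf [set \sum_(i <oo) hausdorff_gauge k (U i) | U in
    [set U : (set M)^nat | A `<=` \bigcup_i U i /\
                           forall i, diam (U i) <= delta%:E]].

(* k-dimensional Hausdorff outer measure, without normalising constant *)
Definition hausdorff (k : nat) A : \bar R :=
  ereal_sup [set hausdorff_pre k delta A | delta in [set delta | (0 < delta)%R]].

Lemma diam_ub A x y : A x -> A y -> (mdist x y)%:E <= diam A.
Proof. by move=> Ax Ay; apply: ereal_sup_ubound; exists x => //; exists y. Qed.

Lemma diam_set0 : diam set0 = -oo.
Proof.
rewrite /diam (_ : [set _ | _ in _ & _ in _] = set0) ?ereal_sup0//.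
by rewrite -subset0 => x [].
Qed.

Lemma hausdorff_gauge0 k : hausdorff_gauge k set0 = 0.
Proof. by rewrite /hausdorff_gauge; case: asboolP. Qed.

Lemma hausdorff_gauge_ge0 k A : 0 <= hausdorff_gauge k A.
Proof.
rewrite /hausdorff_gauge; case: asboolP => // /eqP /set0P[x Ax].
by rewrite expe_ge0// (le_trans _ (diam_ub Ax Ax))// lee_fin mdist_ge0.
Qed.
Hint Resolve hausdorff_gauge_ge0 : core.

Lemma hausdorff_pre_ge0 k delta A : 0 <= hausdorff_pre k delta A.
Proof. by apply: le_ereal_inf_tmp => _ [U _ <-]; exact: nneseries_ge0. Qed.

Lemma le_hausdorff_pre k delta :
  {homo hausdorff_pre k delta : A B / A `<=` B >-> A <= B}.
Proof.
move=> A B AB; apply: ereal_inf_le_tmp => _ [U [BU dU] <-].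
by exists U => //; split => //; exact: subset_trans BU.
Qed.

Lemma hausdorff_pre_delta k (d1 d2 : R) A : (d1 <= d2)%R ->
  hausdorff_pre k d2 A <= hausdorff_pre k d1 A.
Proof.
move=> d12; apply: ereal_inf_le_tmp => _ [U [AU dU] <-].
by exists U => //; split => // i; rewrite (le_trans (dU i))// lee_fin.
Qed.

Lemma hausdorff_pre0 k delta : hausdorff_pre k delta set0 = 0.
Proof.
apply/eqP; rewrite eq_le hausdorff_pre_ge0 andbT.
apply: ereal_inf_lbound; exists (fun=> set0).
  by split => // i; rewrite diam_set0 leNye.
by rewrite eseries0// => i _ _; rewrite hausdorff_gauge0.
Qed.

Lemma hausdorff_pre_sigma_subadditive k delta :
  sigma_subadditive (hausdorff_pre k delta).
Proof.
move=> A; have [[i ioo]|] := pselect (exists i, hausdorff_pre k delta (A i) = +oo).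
  rewrite (eseries_pinfty _ _ ioo) ?leey// => n _.
  by rewrite -ltNye (lt_le_trans _ (hausdorff_pre_ge0 _ _ _)).
rewrite -forallNE => Aoo.
suff add2e (e : {posnum R}) : hausdorff_pre k delta (\bigcup_n A n) <=
    \sum_(i <oo) hausdorff_pre k delta (A i) + e%:num%:E.
  by apply/lee_addgt0Pr => _/posnumP[].
rewrite (le_trans _ (epsilon_trick _ _ _))//; last first.
  by move=> n; exact: hausdorff_pre_ge0.
pose P n (B : (set M)^nat) :=
  (A n `<=` \bigcup_i B i /\ forall i, diam (B i) <= delta%:E) /\
  \sum_(j <oo) hausdorff_gauge k (B j) <=
    hausdorff_pre k delta (A n) + (e%:num / (2 ^ n.+1)%:R)%:E.
have [G PG] : {G : ((set M)^nat)^nat & forall n, P n (G n)}.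
  apply: (@choice _ _ P) => n; rewrite /P.
  have fA : hausdorff_pre k delta (A n) \is a fin_num.
    by rewrite ge0_fin_numE ?hausdorff_pre_ge0// ltey; apply/eqP/Aoo.
  have en1 : (0 < e%:num / (2 ^ n.+1)%:R)%R by [].
  have [x [B HB <-] ltB] := lb_ereal_inf_adherent en1 fA.
  by exists B; split => //; exact/ltW.
apply: (@le_trans _ _ (\esum_(i in setT) (hausdorff_gauge k \o uncurry G) i)).
  apply: ereal_inf_lbound => /=.
  have /card_esym/ppcard_eqP[f] := card_nat2.
  exists (uncurry G \o f).
    split => [t [n _ /(PG n).1.1[j _ Gt]]|i].
      by exists (f^-1%FUN (n, j)) => //=; rewrite invK ?inE.
    by rewrite /=; case: (f i) => a b /=; exact: (PG a).1.2.
  rewrite -(esum_pred_image (hausdorff_gauge k \o uncurry G) _ xpredT)//;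
    rewrite ?[fun=> _]set_true//.
    by rewrite image_eq.
  by move=> *; exact: hausdorff_gauge_ge0.
rewrite (_ : esum _ _ = \sum_(i <oo) \sum_(j <oo) hausdorff_gauge k (G i j)).
  apply: lee_nneseries => [i _ _|n _]; first by apply: nneseries_ge0 => *; exact: hausdorff_gauge_ge0.
  exact: (PG n).2.
pose J : nat -> set (nat * nat) := fun i => [set (i, j) | j in setT].
rewrite (_ : setT = \bigcup_k J k); last first.
  by rewrite predeqE => -[a b]; split => // _; exists a => //; exists b.
rewrite esum_bigcupT /=; last 2 first.
- apply/trivIsetP => i j _ _ ij.
  rewrite predeqE => -[n m] /=; split => //= -[] [_] _ [<-{n} _].
  by move=> [m' _] [] /esym/eqP; rewrite (negbTE ij).
- by move=> [n m].
rewrite -(image_id [set: nat]) -fun_true esum_pred_image//; last first.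
  by move=> n _; exact: esum_ge0.
apply: eq_eseriesr => /= j _.
rewrite -(esum_pred_image (hausdorff_gauge k \o uncurry G) (pair j) predT)//=;
  last first.
  by move=> ? ? _ _; exact: (@can_inj _ _ _ snd).
by congr esum; rewrite predeqE => -[a b]; split; move=> [i _ <-]; exists i.
Qed.

Lemma hausdorff_pre_le k delta A : (0 < delta)%R ->
  hausdorff_pre k delta A <= hausdorff k A.
Proof. by move=> d0; apply: ereal_sup_ubound; exists delta. Qed.

Let hausdorff0 k : hausdorff k set0 = 0.
Proof.
apply/eqP; rewrite eq_le; apply/andP; split.
  by apply: ge_ereal_sup => _ [d _ <-]; rewrite hausdorff_pre0.
by rewrite -(hausdorff_pre0 k 1) hausdorff_pre_le.
Qed.

Let hausdorff_ge0 k A : 0 <= hausdorff k A.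
Proof. exact: le_trans (hausdorff_pre_ge0 k 1 A) (hausdorff_pre_le _ _ _). Qed.

Let le_hausdorff k : {homo hausdorff k : A B / A `<=` B >-> A <= B}.
Proof.
move=> A B AB; apply: ge_ereal_sup => _ [d d0 <-].
exact: le_trans (le_hausdorff_pre _ _ AB) (hausdorff_pre_le _ _ _).
Qed.

Let hausdorff_sigma_subadditive k : sigma_subadditive (hausdorff k).
Proof.
move=> A; apply: ge_ereal_sup => _ [d d0 <-].
apply: (le_trans (hausdorff_pre_sigma_subadditive _ _ _)).
apply: lee_nneseries => [i _ _|n _]; first exact: hausdorff_pre_ge0.
exact: hausdorff_pre_le.
Qed.

HB.instance Definition _ k := isOuterMeasure.Build R M (hausdorff k)
  (hausdorff0 k) (hausdorff_ge0 k) (@le_hausdorff k)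
  (@hausdorff_sigma_subadditive k).

Lemma hausdorff_pre_separated k (delta e : R) A B :
  (0 < delta)%R -> (delta < e)%R ->
  (forall x y, A x -> B y -> (e <= mdist x y)%R) ->
  hausdorff_pre k delta A + hausdorff_pre k delta B <=
    hausdorff_pre k delta (A `|` B).
Proof.
move=> d0 de sep; apply: le_ereal_inf_tmp => _ [U [ABU dU] <-].
pose V (C : set M) i := if `[< U i `&` C !=set0 >] then U i else set0.
have VP (C : set M) : C `<=` A `|` B ->
    hausdorff_pre k delta C <= \sum_(i <oo) hausdorff_gauge k (V C i).
  move=> CAB; apply: ereal_inf_lbound; exists (V C) => //; split => [t Ct|i].
    have [i _ Ut] := ABU _ (CAB _ Ct); exists i => //; rewrite /V.
    by case: asboolP => //; case; exists t.
  by rewrite /V; case: asboolP => // _; rewrite diam_set0 leNye.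
apply: (le_trans (leeD (VP _ (@subsetUl _ _ _)) (VP _ (@subsetUr _ _ _)))).
rewrite -nneseriesD//.
apply: lee_nneseries => [i _ _|i _]; first exact: adde_ge0.
rewrite /V; case: asboolP => [[x [Ux Ax]]|_]; case: asboolP => [[y [Uy By]]|_];
  rewrite ?hausdorff_gauge0 ?adde0 ?add0e//.
have := le_trans (diam_ub Ux Uy) (dU i); rewrite lee_fin => xyd.
by have := lt_le_trans (le_lt_trans xyd de) (sep _ _ Ax By); rewrite ltxx.
Qed.

(* Hausdorff measure is a metric outer measure. *)
Lemma hausdorff_separated k (e : R) A B : (0 < e)%R ->
  (forall x y, A x -> B y -> (e <= mdist x y)%R) ->
  hausdorff k A + hausdorff k B <= hausdorff k (A `|` B).
Proof.
move=> e0 sep.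
have [->|ABoo] := eqVneq (hausdorff k (A `|` B)) +oo; first by rewrite leey.
have fin C : C `<=` A `|` B -> hausdorff k C \is a fin_num.
  move=> CAB; rewrite ge0_fin_numE ?hausdorff_ge0//.
  by rewrite (le_lt_trans (le_hausdorff k CAB))// ltey.
rewrite -leeBrDr ?fin//; apply: ge_ereal_sup => _ [d1 d10 <-].
rewrite leeBrDr ?fin// addeC -leeBrDr; last first.
  rewrite ge0_fin_numE ?hausdorff_pre_ge0//.
  rewrite (le_lt_trans (hausdorff_pre_le _ _ d10))//.
  by rewrite -ge0_fin_numE ?hausdorff_ge0// fin.
apply: ge_ereal_sup => _ [d2 d20 <-].
rewrite leeBrDr; last first.
  rewrite ge0_fin_numE ?hausdorff_pre_ge0//.
  rewrite (le_lt_trans (hausdorff_pre_le _ _ d10))//.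
  by rewrite -ge0_fin_numE ?hausdorff_ge0// fin.
pose d : R := Num.min (e / 2)%R (Num.min (d1 : R) (d2 : R)).
have d0 : (0 < d)%R by rewrite !lt_min d10 d20 divr_gt0.
have de : (d < e)%R by rewrite gt_min; apply/orP; left; lra.
apply: le_trans (hausdorff_pre_le _ _ d0).
apply: le_trans (hausdorff_pre_separated k d0 de sep).
rewrite addeC; apply: leeD; apply: hausdorff_pre_delta.
  by rewrite /d !ge_min lexx !orbT.
by rewrite /d !ge_min lexx !orbT.
Qed.

Lemma open_hausdorff_caratheodory k (O : set M) :
  open O -> (hausdorff k).-caratheodory O.
Proof.
move=> oO; apply: le_caratheodory_measurable => X /=.
have [->|Xoo] := eqVneq (hausdorff k X) +oo; first by rewrite leey.
have fin C : C `<=` X -> hausdorff k C \is a fin_num.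
  move=> CX; rewrite ge0_fin_numE ?hausdorff_ge0//.
  by rewrite (le_lt_trans (le_hausdorff k CX))// ltey.
pose B (n : nat) := [set x : M | forall y, ~ O y -> (n.+1%:R^-1 <= mdist x y)%R].
have BS n : B n `<=` B n.+1.
  move=> x Bx y /Bx; apply: le_trans.
  by rewrite lef_pV2 ?posrE ?ltr0n// ler_nat.
have BO n : B n `<=` O.
  move=> x Bx; apply: contrapT => /Bx; rewrite mdistxx.
  by rewrite leNgt invr_gt0 ltr0n.
have OB : O = \bigcup_n B n.
  apply/seteqP; split=> [x Ox|x [n _]]; last exact: BO.
  have /nbhs_ballP[e /= e0 eO] : nbhs x O by exact: open_nbhs_nbhs.
  have [n ne] : exists n : nat, (n.+1%:R^-1 <= e)%R.
    exists (Num.trunc e^-1); rewrite -[leRHS]invrK lef_pV2 ?posrE ?invr_gt0 ?ltr0n//.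
    by apply/ltW; rewrite truncnS_gt.
  exists n => // y Oy; apply: (le_trans ne); rewrite leNgt; apply/negP => xy.
  by apply: Oy; apply: eO; rewrite ballEmdist.
have sepB n x y : B n x -> ~ B n.+1 y ->
    (n.+1%:R^-1 - n.+2%:R^-1 <= mdist x y)%R.
  move=> Bx /existsNP[z /not_implyP[Oz /negP]]; rewrite -ltNge => yz.
  rewrite lerBlDr (le_trans (Bx z Oz))// (le_trans (metric_triangle x y z))//.
  by rewrite lerD2l ltW.
have gap n : (0 < n.+1%:R^-1 - n.+2%:R^-1 :> R)%R.
  by rewrite subr_gt0 ltf_pV2 ?posrE ?ltr0n// ltr_nat.
pose a n := hausdorff k (X `&` B n).
pose d n := hausdorff k (X `&` (B n.+1 `\` B n)).
have aX n : a n <= hausdorff k X by apply: le_hausdorff => x [].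
have dX n : d n <= hausdorff k X by apply: le_hausdorff => x [].
have ad n : a n + d n.+1 <= a n.+2.
  apply: (@le_trans _ _ (hausdorff k
    ((X `&` B n) `|` (X `&` (B n.+2 `\` B n.+1))))).
    apply: (hausdorff_separated k (gap n)) => x y [_ Bx] [_ [_ By]].
    exact: sepB.
  apply: le_hausdorff => x [[Xx Bx]|[Xx [Bx _]]]; split => //.
  exact/BS/BS.
have sumd n : \sum_(0 <= i < n.+1) d i <= d 0%N + a n + a n.+1.
  elim: n => [|n ih].
    by rewrite big_nat1 -addeA leeDl// adde_ge0// hausdorff_ge0.
  rewrite big_nat_recr//=; apply: (le_trans (leeD2r _ ih)).
  rewrite -(addeA (d 0%N)) (addeC (a n)) addeA -(addeA _ (a n)).
  by apply: leeD2l; exact: ad.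
have sumdoo : \sum_(i <oo) d i < +oo.
  apply: (@le_lt_trans _ _ (hausdorff k X + hausdorff k X + hausdorff k X)).
    apply: lime_le; first by apply: is_cvg_nneseries => *; exact: hausdorff_ge0.
    exists 1%N => // -[//|n] _ /=; apply: (le_trans (sumd n)).
    by rewrite !leeD.
  by rewrite -ge0_fin_numE ?adde_ge0 ?hausdorff_ge0// !fin_numD !fin.
have tail := nneseries_tail_cvg sumdoo (fun i _ => hausdorff_ge0 k _).
have key n : hausdorff k (X `&` O) + hausdorff k (X `&` ~` O) <=
    hausdorff k X + \sum_(n <= i <oo) d i.
  have XO : hausdorff k (X `&` O) <= a n + \sum_(n <= i <oo) d i.
    pose F i := if i is j.+1 then X `&` (B (j + n).+1 `\` B (j + n)%N)
      else X `&` B n.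
    have BD p q : (p <= q)%N -> B p `<=` B q.
      move=> /subnK <-; elim: (q - p)%N => // l ih x /ih; exact: BS.
    have XF : X `&` O `<=` \bigcup_i F i.
      move=> x [Xx]; rewrite OB => -[m _].
      elim: m => [|m ih] Bx; first by exists 0%N => //; split => //; exact: BD Bx.
      have [/ih//|nBx] := pselect (B m x).
      have [nm|mn] := leqP n m.
        by exists (m - n).+1 => //=; rewrite subnK.
      by exists 0%N => //; split => //; exact: BD Bx.
    apply: (le_trans (le_hausdorff k XF)).
    apply: (le_trans (hausdorff_sigma_subadditive k F)).
    have F0 i : 0 <= hausdorff k (F i) by case: i => *; exact: hausdorff_ge0.
    rewrite nneseries_recl// leeD2l// -nneseries_addn//.
    rewrite -(nneseries_addn n); last by move=> *; exact: hausdorff_ge0.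
    by under eq_eseriesr do rewrite addn1.
  apply: (le_trans (leeD2r _ XO)).
  rewrite addeAC leeD2r// addeC.
  apply: (@le_trans _ _ (hausdorff k ((X `&` B n) `|` (X `&` ~` O)))).
    rewrite addeC.
    have n0 : (0 < n.+1%:R^-1 :> R)%R by rewrite invr_gt0 ltr0n.
    apply: (hausdorff_separated k n0) => x y [_ Bx] [_ Oy]; exact: Bx.
  by apply: le_hausdorff => x [[]|[]].
have lim : hausdorff k X + \sum_(n <= i <oo) d i @[n --> \oo] --> hausdorff k X.
  rewrite -[X in _ --> X]adde0; apply: cvgeD => //; last exact: cvg_cst.
  by rewrite fin_num_adde_defr ?fin.
rewrite -(cvg_lim _ lim)//; apply: lime_ge; first by apply/cvg_ex; exists (hausdorff k X).
exact: nearW.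
Qed.

End hausdorff.

Section hausdorff_measure.
Context (R : realType) (M : pointedMetricType R) (k : nat).
Local Open Scope ereal_scope.

Definition borel : Type := g_sigma_algebraType (@open M).
HB.instance Definition _ := Measurable.on borel.

Definition hausdorff_measure (A : set borel) : \bar R := hausdorff k (A : set M).

Let measure0 : hausdorff_measure set0 = 0.
Proof. exact: outer_measure0. Qed.

Let measure_ge0 A : 0 <= hausdorff_measure A.
Proof. exact: outer_measure_ge0. Qed.

Lemma borel_hausdorff_caratheodory (A : set borel) :
  measurable A -> (@hausdorff R M k).-caratheodory A.
Proof.
apply: smallest_sub; last by move=> O; exact: open_hausdorff_caratheodory.
split; first exact: caratheodory_measurable_set0.
- by move=> B mB; rewrite setTD; exact: caratheodory_measurable_setC.
- by move=> F mF; exact: caratheodory_measurable_bigcup.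
Qed.

Let measure_sigma_additive : semi_sigma_additive hausdorff_measure.
Proof.
move=> F mF tF mUF.
apply: (@caratheodory_measure_sigma_additive R M (@hausdorff R M k)) => //.
- by move=> i; exact: borel_hausdorff_caratheodory.
- exact: borel_hausdorff_caratheodory.
Qed.

HB.instance Definition _ := isMeasure.Build _ borel R hausdorff_measure
  measure0 measure_ge0 measure_sigma_additive.

End hausdorff_measure.

(* power_prob mu n is the n-fold product measure mu^n on n-tuples. *)
Section power_probability.
Context d (T : measurableType d) (R : realType).
Local Open Scope ereal_scope.

Definition tuple_cons n (p : T * n.-tuple T) : n.+1.-tuple T :=
  [the n.+1.-tuple T of p.1 :: p.2].

Lemma measurable_tuple_cons n :
  measurable_fun [set: T * n.-tuple T] (@tuple_cons n).
Proof. by apply: measurable_cons. Qed.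

HB.instance Definition _ n :=
  isMeasurableFun.Build _ _ _ _ (@tuple_cons n) (@measurable_tuple_cons n).

Fixpoint power_prob (mu : probability T R) n : probability (n.-tuple T) R :=
  match n with
  | 0 => dirac [tuple]
  | m.+1 => distribution (mu \x power_prob mu m) (@tuple_cons m)
  end.

End power_probability.

(* An edge of the complete graph on 'I_n is given by its endpoints in
   increasing order, and a graph on 'I_n by its set of edges. *)
Definition edge (n : nat) := {e : 'I_n * 'I_n | (e.1 < e.2)%N}.
Definition graph (n : nat) := {set edge n}.
Definition graph_property (n : nat) := {set graph n}.

Definition monotone_property n (F : graph_property n) :=
  forall G H : graph n, G \subset H -> G \in F -> H \in F.

Definition nontrivial_property n (F : graph_property n) :=
  F != finset.set0 /\ F != [set: graph n]%SET.

Section thresholds.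
Context {R : realType} {M : pointedMetricType R}.

Definition geometric_graph n (x : n.-tuple M) (r : R) : graph n :=
  [set e : edge n | mdist (tnth x (val e).1) (tnth x (val e).2) <= r]%SET.

Definition rgg_prob (mu : probability (borel M) R) n (r : R)
    (F : graph_property n) : \bar R :=
  power_prob mu n [set x : n.-tuple (borel M) | geometric_graph x r \in F].

Definition is_threshold (mu : probability (borel M) R)
    (F : forall n, graph_property n) (r : R^nat) :=
  (forall n, 0 < r n) /\
  forall s : R^nat, (forall n, 0 <= s n) ->
    (s n / r n @[n --> \oo] --> 0 ->
       rgg_prob mu (s n) (F n) @[n --> \oo] --> 0%E) /\
    (s n / r n @[n --> \oo] --> +oo ->
       rgg_prob mu (s n) (F n) @[n --> \oo] --> 1%E).

(* There is no nontrivial property on fewer than two vertices. *)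
Definition admits_thresholds (mu : probability (borel M) R) :=
  forall F : forall n, graph_property n,
    (forall n, (2 <= n)%N -> monotone_property (F n) /\
                             nontrivial_property (F n)) ->
    exists r : R^nat, is_threshold mu F r.

End thresholds.

Section sphere.
Context {R : realType} {d : nat}.

Definition dot (u v : 'rV[R]_d.+1) : R := \sum_i u 0 i * v 0 i.

Record sphere := Sphere {
  sphere_val :> 'rV[R]_d.+1 ;
  sphere_prop : dot sphere_val sphere_val == 1 }.

HB.instance Definition _ := [isSub for sphere_val].
HB.instance Definition _ := [Choice of sphere by <:].

Lemma dotC u v : dot u v = dot v u.
Proof. by apply: eq_bigr => i _; rewrite mulrC. Qed.

Lemma dotDl u v w : dot (u + v) w = dot u w + dot v w.
Proof. by rewrite -big_split; apply: eq_bigr => i _ /=; rewrite !mxE mulrDl. Qed.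

Lemma dotZl a u v : dot (a *: u) v = a * dot u v.
Proof. by rewrite /dot big_distrr; apply: eq_bigr => i _ /=; rewrite !mxE mulrA. Qed.

Lemma dotDr u v w : dot w (u + v) = dot w u + dot w v.
Proof. by rewrite dotC dotDl !(dotC w). Qed.

Lemma dotZr a u v : dot v (a *: u) = a * dot v u.
Proof. by rewrite dotC dotZl (dotC v). Qed.

Lemma dot_ge0 u : 0 <= dot u u.
Proof. by apply: sumr_ge0 => i _; rewrite -expr2 sqr_ge0. Qed.

Lemma dot_eq0 u : dot u u = 0 -> u = 0.
Proof.
move=> /eqP; rewrite psumr_eq0 => [/allP u0|i _]; last by rewrite -expr2 sqr_ge0.
apply/rowP => i; rewrite mxE; apply/eqP.
by have := u0 i (mem_index_enum i); rewrite -expr2 sqrf_eq0.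
Qed.

Lemma dot_CauchySchwarz u v : dot u v ^+ 2 <= dot u u * dot v v.
Proof.
have [v0|v0] := eqVneq (dot v v) 0.
  by rewrite v0 mulr0 (dot_eq0 v0) /dot big1 ?expr0n// => i _; rewrite mxE mulr0.
have vp : 0 < dot v v by rewrite lt_def v0 dot_ge0.
have := dot_ge0 (dot v v *: u + (- dot u v) *: v).
rewrite !(dotDl, dotDr, dotZl, dotZr) (dotC v u).
rewrite (_ : _ + _ = dot v v * (dot u u * dot v v - dot u v ^+ 2)); last by ring.
by rewrite pmulr_rge0// subr_ge0.
Qed.

Lemma dot_sphere1 (x : sphere) : dot x x = 1.
Proof. exact/eqP/sphere_prop. Qed.

Lemma dot_sphere_bound (x y : sphere) : -1 <= dot x y <= 1.
Proof.
have := dot_CauchySchwarz x y; rewrite !dot_sphere1 mulr1 => h.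
by rewrite -ler_norml -sqrtr_sqr -[leRHS]sqrtr1 ler_wsqrtr.
Qed.

(* length of the great-circle arc between x and y *)
Definition geodesic (x y : sphere) : R := acos (dot x y).

Let geodesicxx x : geodesic x x = 0.
Proof. by rewrite /geodesic dot_sphere1 acos1. Qed.

Let geodesic_positivity x y : geodesic x y = 0 -> x = y.
Proof.
move=> xy0; have xy1 : dot x y = 1.
  by rewrite -[LHS]acosK ?in_itv/= ?dot_sphere_bound// [acos _]xy0 cos0.
apply/val_inj/eqP; rewrite -subr_eq0 -scaleN1r; apply/eqP/dot_eq0.
rewrite !(dotDl, dotDr, dotZl, dotZr) !dot_sphere1 (dotC (val y)) [dot _ _]xy1.
ring.
Qed.

Let geodesic_sym x y : geodesic x y = geodesic y x.
Proof. by rewrite /geodesic dotC. Qed.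

Let geodesic_triangle y x z : geodesic x z <= geodesic x y + geodesic y z.
Proof.
rewrite /geodesic.
have bxy := dot_sphere_bound x y; have byz := dot_sphere_bound y z.
have bxz := dot_sphere_bound x z.
set a := dot x y in bxy *; set b := dot y z in byz *; set c := dot x z in bxz *.
have [pi_le|lt_pi] := leP pi (acos a + acos b).
  by rewrite (le_trans _ pi_le)// acos_lepi.
have ab_itv : acos a + acos b \in `[0, pi].
  by rewrite in_itv/= addr_ge0 ?acos_ge0//= ltW.
have c_itv : acos c \in `[0, pi] by rewrite in_itv/= acos_ge0// acos_lepi.
rewrite leNgt; apply/negP => lt_ab.
have : cos (acos c) < cos (acos a + acos b) by rewrite ltr_cos.
rewrite cosD !acosK ?in_itv//= !sin_acos// -sqrtrM; last first.
  by rewrite subr_ge0 -real_normK ?num_real// expr_le1// ler_norml.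
suff : a * b - c <= Num.sqrt ((1 - a ^+ 2) * (1 - b ^+ 2)).
  by move=> h; rewrite ltNge lerBlDr -lerBlDl h.
have := dot_CauchySchwarz ((x : 'rV__) + (- a) *: (y : 'rV__))
  ((z : 'rV__) + (- b) *: (y : 'rV__)).
rewrite !(dotDl, dotDr, dotZl, dotZr) !dot_sphere1 (dotC y x) (dotC z y).
rewrite -/a -/b -/c => h.
apply: (le_trans (ler_norm _)); rewrite -sqrtr_sqr ler_wsqrtr//.
move: h; rewrite (_ : (_ + _) ^+ 2 = (a * b - c) ^+ 2); last by ring.
by move=> /le_trans; apply; rewrite le_eqVlt; apply/orP; left; apply/eqP; ring.
Qed.

HB.instance Definition _ := isMetric.Build R sphere
  geodesicxx geodesic_positivity geodesic_sym geodesic_triangle.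

Lemma north_pole_subproof : dot (delta_mx 0 ord0) (delta_mx 0 ord0) == 1.
Proof.
rewrite /dot (bigD1 ord0)//= big1 => [|i i0]; first by rewrite !mxE !eqxx mulr1 addr0.
by rewrite !mxE (negbTE i0) andbF mulr0.
Qed.

HB.instance Definition _ := isPointed.Build sphere (Sphere north_pole_subproof).

End sphere.

Arguments sphere : clear implicits.

(* The area measure is the d-dimensional Hausdorff measure of the geodesic
   distance, up to a constant that normalisation removes. The second argument
   of mnormalize is a default value for a total mass equal to 0 or +oo; it plays
   no role, because the sphere has positive finite d-dimensional Hausdorff
   measure. *)
Definition uniform_sphere (R : realType) (d : nat) :
    probability (borel (sphere R d)) R :=
  mnormalize (hausdorff_measure d) (dirac point).

(* Main.v *)
(** Fix n >= 2 and write f(r) for the probability that the graph at radius r has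
the property. The aim is f(r) <= p - c p (1 - p) with p = f(4r) and c > 0
depending on d only: iterating it in both directions from a radius r with
f(r) <= 1/2 <= f(4r) gives geometric decay of f below r and of 1 - f above 4r.

To prove it, double the angle in a coordinate plane: this map of the sphere is
2-Lipschitz and preserves the uniform measure, and so does its composition with
the folding q |-> |q| of one coordinate of that plane. Conjugating both by the
reflection in a random direction v gives maps Phi_v and Psi_v. Applied to every
point of a configuration whose graph at radius r has the property, either of them
yields a configuration whose graph at radius 4r has it; so the indicator h of the
latter event satisfies E (h(Phi_v x) - h(Psi_v x))^2 <= 2 (p - f(r)).

Conversely E (h(Phi_v x) - h(Psi_v x))^2 >= c' Var h = c' p (1 - p). For one point,
Psi_v x is Phi_v x or its mirror image in the reflected pole s_v(e_0), each half
of the time, which bounds the left side below by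
1/4 E (h(x) - h(sigma_v x))^2 with sigma_v this mirror reflection; as v varies,
sigma_v x spreads over the sphere with a density bounded below, because
v |-> sigma_v x is Lipschitz and onto and the uniform measure is a Hausdorff
measure. For n points one argues by induction, splitting off the mean of h over
the first point. *)
Require Import Defs.
From mathcomp Require Import all_boot all_order all_algebra.
From mathcomp Require Import all_classical all_reals all_analysis.
From mathcomp Require Import measurable_realfun.
From mathcomp Require Import ring lra.

Set Implicit Arguments.
Unset Strict Implicit.
Unset Printing Implicit Defensive.

Import Order.TTheory GRing.Theory Num.Theory.
Import numFieldNormedType.Exports.
Local Open Scope classical_set_scope.
Local Open Scope ring_scope.

(** * Means of bounded measurable functions *)

Section bounded_measurable.
Context d (T : measurableType d) (R : realType).
Implicit Types f g : T -> R.

(** Every function integrated below has this form: it is integrable for every probability, so the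
    real-valued integral is linear and monotone, and products, compositions and partial integrals
    stay in the class. *)
Definition bounded_measurable f :=
  measurable_fun [set: T] f /\ exists M, forall x, `|f x| <= M.

Lemma bounded_measurable_cst (r : R) : bounded_measurable (fun=> r).
Proof. by split; [exact: measurable_cst|exists `|r|]. Qed.

Lemma bounded_measurableD f g : bounded_measurable f -> bounded_measurable g ->
  bounded_measurable (fun x => f x + g x).
Proof.
move=> [mf [M fM]] [mg [N gN]]; split; first exact: measurable_funD.
by exists (M + N) => x; rewrite (le_trans (ler_normD _ _))// lerD.
Qed.

Lemma bounded_measurableM f g : bounded_measurable f -> bounded_measurable g ->
  bounded_measurable (fun x => f x * g x).
Proof.
move=> [mf [M fM]] [mg [N gN]]; split; first exact: measurable_funM.
by exists (M * N) => x; rewrite normrM ler_pM.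
Qed.

Lemma bounded_measurableB f g : bounded_measurable f -> bounded_measurable g ->
  bounded_measurable (fun x => f x - g x).
Proof.
move=> [mf [M fM]] [mg [N gN]]; split; first exact: measurable_funB.
by exists (M + N) => x; rewrite (le_trans (ler_normB _ _))// lerD.
Qed.

Lemma bounded_measurableX2 f : bounded_measurable f ->
  bounded_measurable (fun x => f x ^+ 2).
Proof. by move=> bf; under eq_fun do rewrite expr2; exact: bounded_measurableM. Qed.

Lemma bounded_measurable_indic (A : set T) : measurable A ->
  bounded_measurable (\1_A : T -> R).
Proof.
move=> mA; split; first exact: measurable_indic.
by exists 1 => x; rewrite indicE ger0_norm// lern1; case: (_ \in _).
Qed.

End bounded_measurable.

Lemma bounded_measurable_comp d1 d2 (T1 : measurableType d1)
    (T2 : measurableType d2) (R : realType) (f : T2 -> R) (g : T1 -> T2) :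
  bounded_measurable f -> measurable_fun [set: T1] g ->
  bounded_measurable (fun x => f (g x)).
Proof.
move=> [mf [M fM]] mg; split; last by exists M.
exact: measurableT_comp mf mg.
Qed.

Section bounded_expectation.
Context d (T : measurableType d) (R : realType) (P : probability T R).
Implicit Types f g : T -> R.

Lemma bounded_measurable_integrable f :
  bounded_measurable f -> P.-integrable [set: T] (EFin \o f).
Proof.
move=> [mf [M fM]]; apply: measurable_bounded_integrable => //.
  by rewrite [X in (X < _)%E](_ : _ = 1%E) ?ltry//; exact: probability_setT.
by exists M; split; [exact: num_real|move=> N MN x _; exact: le_trans (fM x) (ltW MN)].
Qed.

Lemma mean_cst (r : R) : \int[P]_(_ in [set: T]) r = r.
Proof. by rewrite Rintegral_cst// [X in fine X](_ : _ = 1%E) ?mulr1//; exact: probability_setT. Qed.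

Lemma meanD f g : bounded_measurable f -> bounded_measurable g ->
  \int[P]_x (f x + g x) = \int[P]_x f x + \int[P]_x g x.
Proof. by move=> bf bg; rewrite RintegralD//; exact: bounded_measurable_integrable. Qed.

Lemma meanB f g : bounded_measurable f -> bounded_measurable g ->
  \int[P]_x (f x - g x) = \int[P]_x f x - \int[P]_x g x.
Proof. by move=> bf bg; rewrite RintegralB//; exact: bounded_measurable_integrable. Qed.

Lemma meanZ f r : bounded_measurable f ->
  \int[P]_x (r * f x) = r * \int[P]_x f x.
Proof. by move=> bf; rewrite RintegralZl//; exact: bounded_measurable_integrable. Qed.

Lemma le_mean f g : bounded_measurable f -> bounded_measurable g ->
  (forall x, f x <= g x) -> \int[P]_x f x <= \int[P]_x g x.
Proof. by move=> bf bg fg; apply: le_Rintegral => //; exact: bounded_measurable_integrable. Qed.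

Lemma mean_ge0 f : (forall x, 0 <= f x) -> 0 <= \int[P]_x f x.
Proof. by move=> f0; exact: Rintegral_ge0. Qed.

(** Meant for indicators: [u] and [v] of two events of probability [a], and [w] of an event of
    probability [b] contained in both. Then [(u - v) ^+ 2 = u + v - 2 u v] and [w <= u v]. *)
Lemma mean_sqrB_le (u v w : T -> R) (a b : R) :
  bounded_measurable u -> bounded_measurable v -> bounded_measurable w ->
  \int[P]_x u x = a -> \int[P]_x v x = a -> \int[P]_x w x = b ->
  (forall x, (u x - v x) ^+ 2 <= u x + v x - 2 * w x) ->
  \int[P]_x (u x - v x) ^+ 2 <= 2 * (a - b).
Proof.
move=> bu bv bw ua va wb uvw.
have b2 := bounded_measurableM (@bounded_measurable_cst _ T R 2) bw.
have buv := bounded_measurableD bu bv.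
rewrite (_ : 2 * (a - b) = \int[P]_x (u x + v x - 2 * w x)).
  apply: le_mean => //; first exact/bounded_measurableX2/bounded_measurableB.
  exact: bounded_measurableB.
by rewrite meanB// meanD// meanZ// ua va wb; ring.
Qed.

Lemma norm_mean f M : bounded_measurable f -> (forall x, `|f x| <= M) ->
  `|\int[P]_x f x| <= M.
Proof.
move=> bf fM; rewrite ler_norml; apply/andP; split.
  rewrite -[leLHS]mean_cst; apply: le_mean => //; first exact: bounded_measurable_cst.
  by move=> x; have := fM x; rewrite ler_norml => /andP[].
rewrite -[leRHS]mean_cst; apply: le_mean => //; first exact: bounded_measurable_cst.
by move=> x; have := fM x; rewrite ler_norml => /andP[].
Qed.

Lemma mean_indic (A : set T) : measurable A -> \int[P]_x (\1_A x : R) = fine (P A).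
Proof. by move=> mA; rewrite /Rintegral integral_indic// setIT. Qed.

End bounded_expectation.

Lemma mean_comp d d' (T : measurableType d) (T' : measurableType d') (R : realType)
    (P : probability T R) (P' : probability T' R) (X : T' -> T) (f : T -> R) :
  measurable_fun [set: T'] X ->
  (forall A, measurable A -> P A = P' (X @^-1` A)) -> bounded_measurable f ->
  \int[P]_x f x = \int[P']_x f (X x).
Proof.
move=> mX PX bf; rewrite /Rintegral.
transitivity (fine (\int[pushforward P' X]_x (f x)%:E)%E).
  congr fine; apply: eq_measure_integral => A mA _; exact: PX.
rewrite integral_pushforward//; first exact/measurable_EFinP/bf.1.
exact/bounded_measurable_integrable/(bounded_measurable_comp bf mX).
Qed.

(** The hypothesis bounds [P] by [K] times the law of [X] under [P']; integrate [f >= 0] against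
    both measures. *)
Lemma le_mean_comp d d' (T : measurableType d) (T' : measurableType d') (R : realType)
    (P : probability T R) (P' : probability T' R) (X : T' -> T) (K : R) (f : T -> R) :
  0 <= K -> measurable_fun [set: T'] X ->
  (forall A, measurable A -> (P A <= K%:E * P' (X @^-1` A))%E) ->
  bounded_measurable f -> (forall x, 0 <= f x) ->
  \int[P]_x f x <= K * \int[P']_x f (X x).
Proof.
move=> K0 mX PX bf f0.
have mEf : measurable_fun [set: T] (EFin \o f) by exact/measurable_EFinP/bf.1.
have bfX := bounded_measurable_comp bf mX.
have fin1 : (\int[P]_x (f x)%:E)%E \is a fin_num.
  exact/integrable_fin_num/bounded_measurable_integrable.
have fin2 : (\int[P']_x (f (X x))%:E)%E \is a fin_num.
  exact/integrable_fin_num/bounded_measurable_integrable.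
rewrite -lee_fin EFinM /Rintegral !fineK//.
apply: (@le_trans _ _ (\int[mscale (NngNum K0) (pushforward P' X)]_x (f x)%:E)%E).
  exact: ge0_le_measure_integral.
rewrite ge0_integral_mscale//=; last by move=> x _; rewrite lee_fin.
by rewrite ge0_integral_pushforward//; last by move=> x _; rewrite lee_fin.
Qed.

Section bounded_fubini.
Context d1 d2 (T1 : measurableType d1) (T2 : measurableType d2) (R : realType).
Implicit Types (P : probability T1 R) (Q : probability T2 R) (f : T1 * T2 -> R).

Lemma bounded_measurable_xsection f x :
  bounded_measurable f -> bounded_measurable (fun y => f (x, y)).
Proof. by move=> bf; exact: bounded_measurable_comp bf (pair1_measurable _). Qed.

Lemma bounded_measurable_ysection f y :
  bounded_measurable f -> bounded_measurable (fun x => f (x, y)).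
Proof. by move=> bf; exact: bounded_measurable_comp bf (pair2_measurable _). Qed.

Let integrable_prod P Q f : bounded_measurable f ->
  (P \x Q)%E.-integrable [set: T1 * T2] (EFin \o f).
Proof. exact: bounded_measurable_integrable. Qed.

Let finF Q f x : bounded_measurable f ->
  (\int[Q]_y (f (x, y))%:E)%E \is a fin_num.
Proof.
move=> bf; apply/integrable_fin_num => //; apply: bounded_measurable_integrable.
exact: bounded_measurable_xsection.
Qed.

Let finG P f y : bounded_measurable f ->
  (\int[P]_x (f (x, y))%:E)%E \is a fin_num.
Proof.
move=> bf; apply/integrable_fin_num => //; apply: bounded_measurable_integrable.
exact: bounded_measurable_ysection.
Qed.

Lemma bounded_measurable_mean2 Q f : bounded_measurable f ->
  bounded_measurable (fun x => \int[Q]_y f (x, y)).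
Proof.
move=> bf; split.
  apply/measurable_EFinP; rewrite (_ : _ \o _ = fubini_F Q (EFin \o f)).
    (* Measurability of a partial integral is a statement about product measures; the Dirac mass is
       an arbitrary choice for the first factor. *)
    exact: measurable_fubini_F (integrable_prod (dirac point) Q bf).
  by apply/funext => x; rewrite /= /Rintegral fineK// finF.
have [_ [M fM]] := bf; exists M => x; apply: norm_mean => //.
exact: bounded_measurable_xsection.
Qed.

Lemma bounded_measurable_mean1 P f : bounded_measurable f ->
  bounded_measurable (fun y => \int[P]_x f (x, y)).
Proof.
move=> bf; split.
  apply/measurable_EFinP; rewrite (_ : _ \o _ = fubini_G P (EFin \o f)).
    exact: measurable_fubini_G (integrable_prod P (dirac point) bf).
  by apply/funext => x; rewrite /= /Rintegral fineK// finG.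
have [_ [M fM]] := bf; exists M => x; apply: norm_mean => //.
exact: bounded_measurable_ysection.
Qed.

Lemma mean_fubini P Q f : bounded_measurable f ->
  \int[P]_x \int[Q]_y f (x, y) = \int[Q]_y \int[P]_x f (x, y).
Proof.
move=> bf; rewrite /Rintegral.
under eq_integral do rewrite fineK ?finF//.
under [in RHS]eq_integral do rewrite fineK ?finG//.
by rewrite (Fubini (integrable_prod P Q bf)).
Qed.

Lemma mean_prod P Q f : bounded_measurable f ->
  \int[(P \x Q)%E]_z f z = \int[Q]_y \int[P]_x f (x, y).
Proof.
move=> bf; rewrite /Rintegral.
under [in RHS]eq_integral do rewrite fineK ?finG//.
by rewrite -integral21_prod_meas1//; exact: integrable_prod.
Qed.

End bounded_fubini.

(** * Power measures and tensorization *)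

Section power_prob_mean.
Context d (T : measurableType d) (R : realType) (mu : probability T R).

Lemma mean_power_prob n (f : n.+1.-tuple T -> R) : bounded_measurable f ->
  \int[power_prob mu n.+1]_x f x =
  \int[power_prob mu n]_t \int[mu]_x f (tuple_cons (x, t)).
Proof.
move=> bf; have mc := @measurable_tuple_cons _ T n.
rewrite (@mean_comp _ _ _ _ R _ (mu \x power_prob mu n)%E (@tuple_cons _ T n))//.
exact: mean_prod (bounded_measurable_comp bf mc).
Qed.

Lemma map_tuple_cons (g : T -> T) n x (t : n.-tuple T) :
  map_tuple g (tuple_cons (x, t)) = tuple_cons (g x, map_tuple g t).
Proof. exact: val_inj. Qed.

Lemma measurable_map_tuple d' (V : measurableType d') (g : V * T -> T) n :
  measurable_fun [set: V * T] g ->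
  measurable_fun [set: V * n.-tuple T]
    (fun p => map_tuple (fun x => g (p.1, x)) p.2).
Proof.
move=> mg; apply/measurable_fun_tnthP => i.
rewrite (_ : _ \o _ = fun p : V * n.-tuple T => g (p.1, tnth p.2 i)); last first.
  by apply/funext => p /=; rewrite tnth_map.
apply: (measurableT_comp mg); apply: measurable_fun_pair => //.
exact: measurableT_comp (measurable_tnth i) measurable_snd.
Qed.

Lemma measurable_map_tuple1 (g : T -> T) n :
  measurable_fun [set: T] g ->
  measurable_fun [set: n.-tuple T] (map_tuple g : n.-tuple T -> n.-tuple T).
Proof.
move=> mg; apply/measurable_fun_tnthP => i.
rewrite (_ : _ \o _ = g \o (@tnth _ _ ^~ i)); last first.
  by apply/funext => p /=; rewrite tnth_map.
exact: measurableT_comp mg (measurable_tnth i).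
Qed.

(** Invariance is stated for means, the form in which it composes and tensorizes; for [double] it is
    also the form in which it gets proved. *)
Definition mean_preserving (g : T -> T) := measurable_fun [set: T] g /\
  forall f : T -> R, bounded_measurable f -> \int[mu]_x f (g x) = \int[mu]_x f x.

Lemma mean_preserving_tuple (g : T -> T) n (f : n.-tuple T -> R) :
  mean_preserving g -> bounded_measurable f ->
  \int[power_prob mu n]_x f (map_tuple g x) = \int[power_prob mu n]_x f x.
Proof.
move=> [mg gmu]; elim: n f => [|n ih] f bf.
  by apply: eq_Rintegral => x _; rewrite tuple0 [in RHS]tuple0.
have mc := @measurable_tuple_cons _ T n.
rewrite !mean_power_prob//; last first.
  exact: bounded_measurable_comp bf (measurable_map_tuple1 mg).
have bfc : bounded_measurable (fun p : T * n.-tuple T => f (tuple_cons p)).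
  exact: bounded_measurable_comp bf mc.
rewrite -(ih (fun t => \int[mu]_x f (tuple_cons (x, t)))); last first.
  exact: (bounded_measurable_mean1 mu bfc).
apply: eq_Rintegral => t _; under eq_Rintegral do rewrite map_tuple_cons.
apply: (gmu (fun x => f (tuple_cons (x, _)))).
exact: (bounded_measurable_ysection _ bfc).
Qed.

End power_prob_mean.

Section tensorization.
Context d (T : measurableType d) (R : realType) (mu : probability T R).
Context d' (V : measurableType d') (nu : probability V R).
Variables (Phi Psi sigma : V * T -> T) (k1 k2 : R).
Hypotheses (mPhi : measurable_fun [set: V * T] Phi)
  (mPsi : measurable_fun [set: V * T] Psi)
  (msigma : measurable_fun [set: V * T] sigma).
Hypothesis Phi_mu : forall v, mean_preserving mu (fun x => Phi (v, x)).
Hypothesis Psi_mu : forall v, mean_preserving mu (fun x => Psi (v, x)).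
Hypotheses (k1_ge0 : 0 <= k1).
(** Two functions are needed even for a single [h]: once the other points are fixed, [Phi] and [Psi]
    move them to different places, so two different sections of [h] get compared. *)
Hypothesis one_particle : forall v (a b : T -> R),
  bounded_measurable a -> bounded_measurable b ->
  k1 * \int[mu]_x (b x - b (sigma (v, x))) ^+ 2 <=
  \int[mu]_x (a (Phi (v, x)) - b (Psi (v, x))) ^+ 2.
Hypothesis spread : forall b : T -> R, bounded_measurable b ->
  k2 * (\int[mu]_x b x ^+ 2 - (\int[mu]_x b x) ^+ 2) <=
  \int[nu]_v \int[mu]_x (b x - b (sigma (v, x))) ^+ 2.

(** Apply [one_particle] to [a] and [b] minus their means. As [Phi] and [Psi] preserve [mu], the
    centred difference has mean 0, so the cross term with the difference of the means vanishes. *)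
Lemma one_particle_centered v (a b : T -> R) :
  bounded_measurable a -> bounded_measurable b ->
  (\int[mu]_x a x - \int[mu]_x b x) ^+ 2 +
  k1 * \int[mu]_x (b x - b (sigma (v, x))) ^+ 2 <=
  \int[mu]_x (a (Phi (v, x)) - b (Psi (v, x))) ^+ 2.
Proof.
move=> ba bb; set ma := \int[mu]_x a x; set mb := \int[mu]_x b x.
have bc (r : R) : bounded_measurable (fun _ : T => r) by exact: bounded_measurable_cst.
pose a' x := a x - ma; pose b' x := b x - mb.
have ba' : bounded_measurable a' by exact: bounded_measurableB.
have bb' : bounded_measurable b' by exact: bounded_measurableB.
have [m1 p1] := Phi_mu v; have [m2 p2] := Psi_mu v.
have ba1 : bounded_measurable (fun x => a' (Phi (v, x))).
  exact: bounded_measurable_comp ba' m1.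
have bb1 : bounded_measurable (fun x => b' (Psi (v, x))).
  exact: bounded_measurable_comp bb' m2.
have b1 := bounded_measurableB ba1 bb1.
have := one_particle v ba' bb'.
have e x : b' x - b' (sigma (v, x)) = b x - b (sigma (v, x)) by rewrite /b'; ring.
under eq_Rintegral do rewrite e.
move=> le1; rewrite [leRHS](_ : _ = \int[mu]_x ((a' (Phi (v, x)) - b' (Psi (v, x))) ^+ 2 +
   (2 * (ma - mb) * (a' (Phi (v, x)) - b' (Psi (v, x))) + (ma - mb) ^+ 2))); last first.
  by apply: eq_Rintegral => x _; rewrite /a' /b'; ring.
have b2 := bounded_measurableX2 b1.
have b3 := bounded_measurableM (bc (2 * (ma - mb))) b1.
have b4 := bounded_measurableD b3 (bc ((ma - mb) ^+ 2)).
rewrite meanD// meanD// meanZ// meanB// mean_cst (p1 a')// (p2 b')// meanB// meanB//.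
by rewrite !mean_cst !subrr mulr0 add0r addrC lerD2r.
Qed.

(** Induction on [n] through the decomposition of the variance over the first point. In
    [one_particle_centered], the squared difference of means is the quantity of the theorem for the
    [n]-point function [h0], and the other term bounds the conditional variance. *)
Theorem tensor_spread n (h : n.-tuple T -> R) : bounded_measurable h ->
  k1 * k2 * (\int[power_prob mu n]_x h x ^+ 2 - (\int[power_prob mu n]_x h x) ^+ 2) <=
  \int[nu]_v \int[power_prob mu n]_x
    (h (map_tuple (fun y => Phi (v, y)) x) - h (map_tuple (fun y => Psi (v, y)) x)) ^+ 2.
Proof.
elim: n h => [|n ih] h bh.
  have hE x : h x = h [tuple] by rewrite (tuple0 x).
  under eq_Rintegral do rewrite hE.
  under [X in _ - X ^+ 2]eq_Rintegral do rewrite hE.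
  rewrite !mean_cst subrr mulr0.
  by apply: mean_ge0 => v; apply: mean_ge0 => x; exact: sqr_ge0.
pose P := power_prob mu n.
have mc := @measurable_tuple_cons _ T n.
pose h1 (p : T * n.-tuple T) := h (tuple_cons p).
have bh1 : bounded_measurable h1 by exact: bounded_measurable_comp bh mc.
pose h0 t := \int[mu]_x h1 (x, t).
have bh0 : bounded_measurable h0 by exact: bounded_measurable_mean1.
pose s t := \int[mu]_x h1 (x, t) ^+ 2.
have bs : bounded_measurable s.
  exact: (bounded_measurable_mean1 mu (bounded_measurableX2 bh1)).
have mapm (G : V * T -> T) : measurable_fun [set: V * T] G ->
    measurable_fun [set: V * n.-tuple T] (fun p => map_tuple (fun x => G (p.1, x)) p.2).
  exact: measurable_map_tuple.
(* The integrand for [n.+1] points, with [v] and the last [n] points grouped so that the first point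
   is integrated first. *)
pose Z (p : (V * n.-tuple T) * T) :=
  h1 (Phi (p.1.1, p.2), map_tuple (fun x => Phi (p.1.1, x)) p.1.2) -
  h1 (Psi (p.1.1, p.2), map_tuple (fun x => Psi (p.1.1, x)) p.1.2).
have bh1G (G : V * T -> T) : measurable_fun [set: V * T] G ->
  bounded_measurable (fun p : (V * n.-tuple T) * T =>
    h1 (G (p.1.1, p.2), map_tuple (fun x => G (p.1.1, x)) p.1.2)).
  move=> mG; apply: (bounded_measurable_comp bh1); apply: measurable_fun_pair.
    apply: (measurableT_comp mG); apply: measurable_fun_pair => //.
    exact: measurableT_comp measurable_fst measurable_fst.
  exact: measurableT_comp (mapm _ mG) measurable_fst.
have bZ : bounded_measurable Z by apply: bounded_measurableB; exact: bh1G.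
have bZ2 := bounded_measurable_mean2 mu (bounded_measurableX2 bZ).
(* The change of [h] when [sigma] moves the first point only; [D2] is its mean square over that
   point. *)
pose D (p : (V * n.-tuple T) * T) :=
  h1 (p.2, p.1.2) - h1 (sigma (p.1.1, p.2), p.1.2).
have bD : bounded_measurable D.
  apply: bounded_measurableB; apply: (bounded_measurable_comp bh1);
    apply: measurable_fun_pair => //.
  - exact: measurableT_comp measurable_snd measurable_fst.
  - apply: (measurableT_comp msigma); apply: measurable_fun_pair => //.
    exact: measurableT_comp measurable_fst measurable_fst.
  - exact: measurableT_comp measurable_snd measurable_fst.
pose D2 (p : V * n.-tuple T) := \int[mu]_x D (p, x) ^+ 2.
have bD2 : bounded_measurable D2.
  exact: (bounded_measurable_mean2 mu (bounded_measurableX2 bD)).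
pose Y (p : V * n.-tuple T) := h0 (map_tuple (fun x => Phi (p.1, x)) p.2) -
  h0 (map_tuple (fun x => Psi (p.1, x)) p.2).
have bY : bounded_measurable Y.
  by apply: bounded_measurableB; apply: (bounded_measurable_comp bh0); exact: mapm.
have bY2 := bounded_measurableX2 bY.
pose D3 (p : V * n.-tuple T) := D2 (p.1, map_tuple (fun x => Psi (p.1, x)) p.2).
have bD3 : bounded_measurable D3.
  apply: (bounded_measurable_comp bD2); apply: measurable_fun_pair => //.
  exact: mapm.
have bc (r : R) : bounded_measurable (fun=> r : R) by exact: bounded_measurable_cst.
have bk := bounded_measurableM (bc _ _ k1) bD3.
rewrite !mean_power_prob//; last exact: bounded_measurableX2.
have -> : \int[nu]_v \int[power_prob mu n.+1]_x
    (h (map_tuple (fun y => Phi (v, y)) x) -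
     h (map_tuple (fun y => Psi (v, y)) x)) ^+ 2 =
    \int[nu]_v \int[P]_t \int[mu]_x Z ((v, t), x) ^+ 2.
  apply: eq_Rintegral => v _; rewrite mean_power_prob; last first.
    apply: bounded_measurableX2; apply: bounded_measurableB;
      apply: (bounded_measurable_comp bh); apply: measurable_map_tuple1.
    - exact: (Phi_mu v).1.
    - exact: (Psi_mu v).1.
  apply: eq_Rintegral => t _; apply: eq_Rintegral => x _.
  by rewrite !map_tuple_cons.
(* Here [a] and [b] are the sections of [h1] at the images of [t] under [Phi] and [Psi]; since
   [sigma] acts on [b], [D2] is evaluated at the [Psi]-image, which is [D3]. *)
have le1 p : Y p ^+ 2 + k1 * D3 p <= \int[mu]_x Z (p, x) ^+ 2.
  case: p => v t; rewrite /Y /D3 /D2 /=.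
  apply: (@one_particle_centered v (fun x => h1 (x, _)) (fun x => h1 (x, _)));
    exact: bounded_measurable_ysection.
apply: (@le_trans _ _ (\int[nu]_v \int[P]_t (Y (v, t) ^+ 2 + k1 * D3 (v, t)))); last first.
  apply: le_mean => [||v].
  - exact: (bounded_measurable_mean2 P (bounded_measurableD bY2 bk)).
  - exact: (bounded_measurable_mean2 P bZ2).
  apply: le_mean => [||t]; last exact: le1.
  - exact: (bounded_measurable_xsection _ (bounded_measurableD bY2 bk)).
  - exact: (bounded_measurable_xsection _ bZ2).
have -> : \int[nu]_v \int[P]_t (Y (v, t) ^+ 2 + k1 * D3 (v, t)) =
    \int[nu]_v \int[P]_t Y (v, t) ^+ 2 + k1 * \int[nu]_v \int[P]_t D2 (v, t).
  rewrite -meanZ; last exact: (bounded_measurable_mean2 P bD2).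
  rewrite -meanD; last 2 first.
  - exact: (bounded_measurable_mean2 P bY2).
  - exact: (bounded_measurableM (bc _ _ k1) (bounded_measurable_mean2 P bD2)).
  apply: eq_Rintegral => v _; rewrite meanD; last 2 first.
  - exact: (bounded_measurable_xsection _ bY2).
  - exact: (bounded_measurable_xsection _ bk).
  rewrite meanZ; last exact: (bounded_measurable_xsection _ bD3).
  (* Since [Psi] preserves the power measure, [D3] and [D2] have the same mean over [t]. *)
  congr (_ + _ * _); rewrite /D3 /=.
  apply: (@mean_preserving_tuple _ _ _ mu _ n (fun t => D2 (v, t))) => //.
  exact: (bounded_measurable_xsection _ bD2).
(* Law of total variance: the variance of [h0] plus the mean of the conditional variance
   [s - h0 ^+ 2]. *)
have -> : k1 * k2 * (\int[P]_t s t - (\int[P]_t h0 t) ^+ 2) =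
    k1 * k2 * (\int[P]_t h0 t ^+ 2 - (\int[P]_t h0 t) ^+ 2) +
    k1 * (k2 * \int[P]_t (s t - h0 t ^+ 2)).
  rewrite meanB//; last exact: bounded_measurableX2.
  by ring.
apply: lerD; first exact: ih.
rewrite ler_wpM2l// mean_fubini// -meanZ; last first.
  by apply: bounded_measurableB => //; exact: bounded_measurableX2.
apply: le_mean => [||t].
- apply: (bounded_measurableM (bc _ _ k2)).
  by apply: bounded_measurableB => //; exact: bounded_measurableX2.
- exact: (bounded_measurable_mean1 nu bD2).
apply: (spread (b := fun x => h1 (x, t))).
exact: bounded_measurable_ysection.
Qed.

End tensorization.

(** * Geodesic distance and coordinates *)

Section chord.
Context {R : realType}.
Implicit Types s t : R.

Lemma sin_mean_value s : 0 <= s ->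
  exists2 c, c \in `[0, s] & sin s = cos c * s.
Proof.
move=> s0; have [|c cs] := @MVT_segment R sin cos 0 s s0 (fun x _ => is_derive_sin x).
  by apply: continuous_subspaceT => x; exact: continuous_sin.
by rewrite sin0 !subr0 => sE; exists c.
Qed.

Lemma onem_cos_double s : 1 - cos (s *+ 2) = 2 * sin s ^+ 2.
Proof. rewrite cos_mulr2n -[in sin _ ^+ 2](subKr 1 (sin s ^+ 2)) -cos2sin2; ring. Qed.

Lemma onem_cos_le t : 0 <= t -> 1 - cos t <= t ^+ 2 / 2.
Proof.
move=> t0; have [c ch sE] := @sin_mean_value (t / 2) ltac:(by rewrite divr_ge0).
rewrite (_ : t = (t / 2) *+ 2); last by rewrite mulr2n; field.
rewrite onem_cos_double sE; set s := t / 2.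
have -> : (s *+ 2) ^+ 2 / 2 = 2 * s ^+ 2 by rewrite mulr2n; field.
by rewrite ler_wpM2l// exprMn ler_piMl ?sqr_ge0//.
Qed.

(** With [t = 4 s] and [s <= pi / 4], halving the angle twice gives
    [1 - cos t = 8 cos(s)^2 sin(s)^2]. Moreover [sin s >= s cos s] by the mean value theorem, and
    [cos(s)^2 >= 1/2] is used twice. *)
Lemma onem_cos_ge t : 0 <= t <= pi -> t ^+ 2 / 8 <= 1 - cos t.
Proof.
move=> /andP[t0 tpi].
have [s s0 t4] : exists2 s, 0 <= s & t = 4 * s.
  by exists (t / 4); [rewrite divr_ge0|field].
have pi0 : 0 < pi :> R := pi_gt0 R.
have tE : t = s *+ 2 *+ 2 by rewrite !(mulr2n (_ + _), mulr2n s) t4; ring.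
have c2 : 0 <= cos (s *+ 2).
  by apply: cos_ge0_pihalf; rewrite (mulr2n s); apply/andP; split; lra.
have cs : 1 / 2 <= cos s ^+ 2 by rewrite cos_mulr2n in c2; lra.
have [c /[!in_itv]/= /andP[c0 csl] sE] := sin_mean_value s0.
have cc : cos s <= cos c.
  by rewrite leNgt ltr_cos ?in_itv/= -?leNgt//; apply/andP; split; lra.
have cos0 : 0 <= cos s.
  by apply: cos_ge0_pihalf; apply/andP; split; lra.
have ss : cos s ^+ 2 * s ^+ 2 <= sin s ^+ 2.
  by rewrite sE exprMn ler_wpM2r ?sqr_ge0// lerXn2r// nnegrE// (le_trans cos0).
rewrite {2}tE onem_cos_double sin_mulr2n.
have -> : 2 * ((cos s * sin s) *+ 2) ^+ 2 = 8 * cos s ^+ 2 * sin s ^+ 2.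
  by rewrite (mulr2n (_ * _)); ring.
have -> : t ^+ 2 / 8 = 2 * s ^+ 2 by rewrite t4; field.
have : cos s ^+ 2 * (cos s ^+ 2 * s ^+ 2) <= cos s ^+ 2 * sin s ^+ 2.
  by rewrite ler_wpM2l// sqr_ge0.
have : 1 / 2 * (1 / 2 * s ^+ 2) <= cos s ^+ 2 * (cos s ^+ 2 * s ^+ 2).
  apply: ler_pM => //; first by rewrite mulr_ge0// sqr_ge0.
  by rewrite ler_wpM2r// sqr_ge0.
lra.
Qed.

End chord.

Section sphere_coordinates.
Context {R : realType} {d : nat}.
Notation S := (sphere R d).

Definition coord (i : 'I_d.+1) (x : S) : R := sphere_val x 0 i.

Implicit Types x y : S.

Lemma sum_sqr_chord x y :
  \sum_i (coord i x - coord i y) ^+ 2 = 2 * (1 - dot x y).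
Proof.
have -> : \sum_i (coord i x - coord i y) ^+ 2 =
    dot x x + dot y y - 2 * dot x y.
  rewrite /dot mulr_sumr -big_split -sumrB; by apply: eq_bigr => i _ /=; rewrite /coord; ring.
rewrite !dot_sphere1; ring.
Qed.

Lemma cos_mdist x y : cos (mdist x y) = dot x y.
Proof. by rewrite acosK// in_itv/= dot_sphere_bound. Qed.

Lemma mdist_itv x y : 0 <= mdist x y <= pi.
Proof. by rewrite mdist_ge0/= acos_lepi// dot_sphere_bound. Qed.

Lemma chord_le_mdist x y : 2 * (1 - dot x y) <= mdist x y ^+ 2.
Proof. by have := onem_cos_le (mdist_ge0 x y); rewrite cos_mdist; lra. Qed.

Lemma mdist_le_chord x y : mdist x y ^+ 2 <= 8 * (1 - dot x y).
Proof. by have := onem_cos_ge (mdist_itv x y); rewrite cos_mdist; lra. Qed.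

(** The squared chord [2 (1 - dot x y)] lies between a quarter of the squared distance and the
    squared distance itself. Hence a map that is [K]-Lipschitz for chords is [2 K]-Lipschitz for the
    geodesic distance. *)
Lemma dot_lipschitz (f : S -> S) (K : R) : 0 <= K ->
  (forall x y, 1 - dot (f x) (f y) <= K ^+ 2 * (1 - dot x y)) ->
  forall x y, mdist (f x) (f y) <= 2 * K * mdist x y.
Proof.
move=> K0 fK x y.
rewrite -(@ler_pXn2r _ 2)// ?nnegrE ?mulr_ge0 ?mdist_ge0//.
apply: (le_trans (mdist_le_chord _ _)).
have := ler_wpM2l (sqr_ge0 K) (chord_le_mdist x y).
have := fK x y; rewrite !exprMn; lra.
Qed.

Lemma coord_le_mdist x y i : `|coord i x - coord i y| <= mdist x y.
Proof.
rewrite -(@ler_pXn2r _ 2)// ?nnegrE ?mdist_ge0// real_normK ?num_real//.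
apply: le_trans (chord_le_mdist x y); rewrite -sum_sqr_chord (bigD1 i)//= lerDl.
by apply: sumr_ge0 => j _; exact: sqr_ge0.
Qed.

Lemma mdist_le_coord x y (e : R) : 0 <= e ->
  (forall i, `|coord i x - coord i y| <= e) ->
  mdist x y <= 2 * d.+1%:R * e.
Proof.
move=> e0 xye.
rewrite -(@ler_pXn2r _ 2)// ?nnegrE ?mulr_ge0 ?mdist_ge0//.
apply: (le_trans (mdist_le_chord _ _)).
have : 2 * (1 - dot x y) <= d.+1%:R * e ^+ 2.
  rewrite -sum_sqr_chord -[d.+1 in leRHS]card_ord -sumr_const mulr_suml.
  apply: ler_sum => i _; rewrite mul1r -(real_normK (num_real (_ - _))).
  by rewrite lerXn2r// nnegrE.
have : d.+1%:R * e ^+ 2 <= d.+1%:R ^+ 2 * e ^+ 2.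
  by rewrite ler_wpM2r ?sqr_ge0// expr2 ler_peMl// ler1n.
rewrite !exprMn; lra.
Qed.

End sphere_coordinates.

(** * Borel measurability on the sphere *)

Section sphere_measurability.
Context {R : realType} {d : nat}.
Notation S := (sphere R d).

Lemma measurable_coord i : measurable_fun [set: borel S] (coord i : borel S -> R).
Proof.
apply: (measurability _ (RGenOpens.measurableE R)).
move=> _ [_ [a [b ->]] <-]; rewrite setTI; apply: sub_sigma_algebra.
suff : @open S ((coord i : S -> R) @^-1` `]a, b[) by [].
rewrite openE => x /=; rewrite in_itv/= => /andP[ax xb].
apply/nbhs_ballP; exists (Num.min (coord i x - a) (b - coord i x)) => /=.
  by rewrite lt_min !subr_gt0 ax.
move=> y; rewrite ballEmdist /= => xy.
have := le_lt_trans (coord_le_mdist x y i) xy.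
rewrite lt_min !ltr_norml in_itv/= => /andP[/andP[_ h1] /andP[h2 _]].
by apply/andP; split; lra.
Qed.

(** Boxes with rational centres and radii [1 / (k + 1)] form a countable base of the topology, so
    measurability of a map into the sphere reduces to that of its coordinates. *)
Let box (q : {ffun 'I_d.+1 -> rat} * nat) : set S :=
  [set x | forall i, `|coord i x - ratr (q.1 i)| < q.2.+1%:R^-1].

Let open_sphere_box (O : set S) : open O ->
  O = \bigcup_(q in [set q | box q `<=` O]) box q.
Proof.
move=> oO; apply/seteqP; split => [x Ox|x [q qO]]; last exact: qO.
have /nbhs_ballP[e /= e0 eO] : nbhs x O by exact: open_nbhs_nbhs.
(* Two points of a box of radius [1 / (k + 1)] have coordinates within twice that radius, and
   [mdist_le_coord] costs a further [2 * d.+1]. *)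
pose k := Num.truncn (4 * d.+1%:R / e).
have ke : 4 * d.+1%:R * k.+1%:R^-1 < e.
  by rewrite ltr_pdivrMr// [e * _]mulrC -ltr_pdivrMr// truncnS_gt.
have k0 : 0 < k.+1%:R^-1 :> R by rewrite invr_gt0.
have qP i : exists q : rat, `|coord i x - ratr q| < k.+1%:R^-1.
  move: k.+1%:R^-1 k0 => r r0; have xk : coord i x < coord i x + r by rewrite ltrDl.
  have [q] := rat_in_itvoo xk; rewrite in_itv/= => /andP[xq qx].
  by exists q; rewrite ltr_norml; apply/andP; split; lra.
have [q {}qP] := choice qP.
exists ([ffun i => q i], k) => /= [y yq|i]; last by rewrite ffunE.
apply: eO; rewrite ballEmdist /=; apply: le_lt_trans ke.
rewrite (_ : 4 * _ * _ = 2 * d.+1%:R * (2 * k.+1%:R^-1)); last by ring.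
apply: mdist_le_coord => [|i]; first by rewrite mulr_ge0// ltW.
have := yq i; rewrite ffunE /= => /ltW yi; have /ltW xi := qP i.
rewrite (_ : _ - _ = (coord i x - ratr (q i)) - (coord i y - ratr (q i))); last by ring.
by rewrite (le_trans (ler_normB _ _))// mulr2n mulrDl mul1r lerD.
Qed.

Lemma measurable_to_sphere d' (T : measurableType d') (f : T -> borel S) :
  (forall i, measurable_fun [set: T] (fun t => coord i (f t))) ->
  measurable_fun [set: T] f.
Proof.
move=> mf; apply: (@measurability _ _ _ _ setT f open) => //.
move=> _ [U /open_sphere_box -> <-]; rewrite setTI preimage_bigcup.
rewrite bigcup_mkcond; apply: countable_bigcupT_measurable; first exact: countableP.
move=> q; case: ifPn => // _.
rewrite (_ : _ @^-1` _ = \bigcap_(i in [set: 'I_d.+1])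
    (fun t => coord i (f t)) @^-1` (ball (ratr (q.1 i) : R) (q.2.+1%:R^-1))).
  apply: fin_bigcap_measurable => // i _; rewrite -[X in measurable X]setTI.
  by apply: mf => //; exact: measurable_ball.
apply/seteqP; split => t tq i; first by move=> _; rewrite /ball /= distrC; exact: tq.
by rewrite distrC; exact: tq.
Qed.

End sphere_measurability.

(** * Hausdorff measure of the sphere *)

Section hausdorff_lipschitz.
Context {R : realType} {M N : pointedMetricType R}.
Local Open Scope ereal_scope.

Lemma le_expe (x y : \bar R) k : 0 <= x -> x <= y -> x ^+ k <= y ^+ k.
Proof.
move=> x0 xy; elim: k => [|k ih]; first by rewrite !expe0.
by rewrite !expeS lee_pmul// expe_ge0.
Qed.

Lemma expeMl (r : R) (x : \bar R) k : (r%:E * x) ^+ k = (r ^+ k)%:E * x ^+ k.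
Proof.
elim: k => [|k ih]; first by rewrite !expe0 mule1.
by rewrite !expeS ih exprS EFinM muleACA.
Qed.

Lemma diam_le (A : set M) (r : \bar R) :
  (forall x y, A x -> A y -> (mdist x y)%:E <= r) -> diam A <= r.
Proof. by move=> Ar; apply: ge_ereal_sup => _ [x Ax [y Ay <-]]; exact: Ar. Qed.

Lemma gauge_le k (A : set M) (r : R) :
  (0 <= r)%R -> (forall x y, A x -> A y -> (mdist x y <= r)%R) ->
  hausdorff_gauge k A <= (r ^+ k)%:E.
Proof.
move=> r0 Ar; rewrite /hausdorff_gauge; case: asboolP => [_|].
  by rewrite lee_fin exprn_ge0.
move/eqP/set0P => [x Ax]; rewrite EFin_expe le_expe//.
  by rewrite (le_trans _ (diam_ub Ax Ax))// lee_fin mdist_ge0.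
by apply: diam_le => y z Ay Az; rewrite lee_fin Ar.
Qed.

Variables (f : M -> N) (L : R).
Hypotheses (L_gt0 : (0 < L)%R)
  (f_lip : forall x y, (mdist (f x) (f y) <= L * mdist x y)%R).

Let diam_image (A : set M) : A !=set0 -> diam (f @` A) <= L%:E * diam A.
Proof.
move=> A0; apply: ge_ereal_sup => _ [_ [x Ax <-] [_ [y Ay <-] <-]].
apply: (@le_trans _ _ (L%:E * (mdist x y)%:E)); first by rewrite -EFinM lee_fin.
by rewrite lee_pmul2l// diam_ub.
Qed.

Let gauge_image k (A : set M) :
  hausdorff_gauge k (f @` A) <= (L ^+ k)%:E * hausdorff_gauge k A.
Proof.
rewrite {1}/hausdorff_gauge; case: asboolP => [_|fA0].
  apply: mule_ge0; last exact: hausdorff_gauge_ge0.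
  by rewrite lee_fin exprn_ge0// ltW.
rewrite /hausdorff_gauge; case: asboolP => [A0|/eqP/set0P A0]; first by rewrite A0 image_set0 in fA0.
rewrite -expeMl le_expe//; last exact: diam_image.
by case: A0 => x Ax; rewrite (le_trans _ (diam_ub (imageP f Ax) (imageP f Ax)))// lee_fin mdist_ge0.
Qed.

(** A cover of [A] of mesh [delta / L] is mapped to a cover of the image of mesh [delta], and each
    gauge grows by at most [L ^+ k]. *)
Lemma hausdorff_lipschitz k (A : set M) :
  hausdorff k (f @` A) <= (L ^+ k)%:E * hausdorff k A.
Proof.
have Lk0 : (0 < L ^+ k)%R by rewrite exprn_gt0.
apply: ge_ereal_sup => _ [delta delta0 <-].
have dL : (0 < delta / L)%R by rewrite divr_gt0.
apply: (@le_trans _ _ ((L ^+ k)%:E * hausdorff_pre k (delta / L) A)); last first.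
  by rewrite lee_pmul2l// hausdorff_pre_le.
rewrite -lee_pdivrMl//; apply: le_ereal_inf_tmp => _ [U [AU dU] <-].
rewrite lee_pdivrMl// -nneseriesZl//; last by move=> *; exact: hausdorff_gauge_ge0.
apply: (@le_trans _ _ (\sum_(i <oo) hausdorff_gauge k (f @` U i))); last first.
  apply: lee_nneseries => [i _ _|i _]; last exact: gauge_image.
  exact: hausdorff_gauge_ge0.
apply: ereal_inf_lbound; exists (fun i => f @` U i) => //; split.
  by move=> _ [x /AU[i _ Ui] <-]; exists i => //; exists x.
move=> i; have [->|/set0P U0] := eqVneq (U i) set0.
  by rewrite image_set0 diam_set0 leNye.
apply: (le_trans (diam_image U0)); apply: (@le_trans _ _ (L%:E * (delta / L)%:E)).
  by rewrite lee_pmul2l.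
by rewrite -EFinM lee_fin mulrC divfK// gt_eqF.
Qed.

End hausdorff_lipschitz.

Lemma measurable_rectangle d (T : measurableType d) n (A : 'I_n -> set T) :
  (forall i, measurable (A i)) ->
  measurable [set t : n.-tuple T | forall i, A i (tnth t i)].
Proof.
move=> mA; rewrite [X in measurable X](_ : _ = \bigcap_(i in [set: 'I_n])
    ((@tnth n T ^~ i) @^-1` A i)).
  apply: fin_bigcap_measurable => // i _; rewrite -[X in measurable X]setTI.
  exact: (measurable_tnth i).
by apply/seteqP; split => [t tA i _|t tA i]; exact: tA.
Qed.

Lemma power_prob_rectangle d (T : measurableType d) (R : realType)
    (mu : probability T R) n (A : 'I_n -> set T) :
  (forall i, measurable (A i)) ->
  power_prob mu n [set t | forall i, A i (tnth t i)] =
  (\prod_(i < n) fine (mu (A i)))%:E.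
Proof.
elim: n A => [|n ih] A mA.
  rewrite big_ord0 [X in power_prob _ _ X](_ : _ = setT) ?probability_setT//.
  by apply/seteqP; split => // t _ [].
rewrite big_ord_recl EFinM -ih//= fineK ?fin_num_measure//.
rewrite /pushforward [X in (_ \x _)%E X](_ : _ = A ord0 `*`
    [set t | forall i, A (lift ord0 i) (tnth t i)]); last first.
  apply/seteqP; split => [[x t] xt|[x t] [/= Ax At] i].
    by split => [|i] /=; [have := xt ord0|have := xt (lift ord0 i)];
      rewrite ?tnth0 ?tnthS.
  by have [j|] := unliftP ord0 i => ->; rewrite ?tnth0 ?tnthS//; exact: At.
rewrite product_measure1E//.
by apply: (@measurable_rectangle _ T n (fun i => A (lift ord0 i))) => i; exact: mA.
Qed.

(** * The sphere has positive Hausdorff measure *)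

Section sphere_positive.
Context {R : realType} {d : nat}.
Notation S := (sphere R d).

Let h : R := d.+1%:R^-1.

Let h_gt0 : 0 < h. Proof. by rewrite invr_gt0. Qed.

Let cube : set (d.-tuple R) := [set t | forall i, `[0, 1]%classic (tnth t i)].

Let lower (t : d.-tuple R) : R := \sum_j (h * tnth t j) ^+ 2.

(** The sphere as a graph over a cube: the scaling [h] keeps the squared norm of the last [d]
    coordinates at most 1 on the unit cube, and coordinate 0 completes the vector to norm 1. *)
Let vec (t : d.-tuple R) : 'rV[R]_d.+1 :=
  \row_i if unlift ord0 i is Some j then h * tnth t j else Num.sqrt (1 - lower t).

Let vec_sphere t : cube t -> dot (vec t) (vec t) == 1.
Proof.
move=> ct; rewrite /dot big_ord_recl !mxE unlift_none.
rewrite (eq_bigr (fun j => (h * tnth t j) ^+ 2)) => [|j _]; last by rewrite !mxE liftK.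
rewrite -expr2 sqr_sqrtr ?subrK// subr_ge0 /lower.
apply: (@le_trans _ _ (\sum_(j < d) h)).
  apply: ler_sum => j _; have := ct j; rewrite /= in_itv/= => /andP[t0 t1].
  have ht : 0 <= h * tnth t j <= h.
    by rewrite mulr_ge0 ?(ltW h_gt0)//= ler_piMr// ltW.
  have h1 : h <= 1 by rewrite invf_le1// ler1n.
  have /andP[ht0 hth] := ht; rewrite expr2 (le_trans _ hth)// ler_piMr//.
  exact: le_trans hth h1.
by rewrite sumr_const card_ord -[leLHS]mulr_natl ler_pdivrMr// mul1r ler_nat.
Qed.

Let box (s : d.-tuple R) (r : R) : set (d.-tuple R) :=
  [set t | forall i, `[tnth s i - r / h, tnth s i + r / h]%classic (tnth t i)].

Let unif := uniform_prob (@ltr01 R).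

Let unif_le (A : set R) : measurable A -> (unif A <= lebesgue_measure A)%E.
Proof.
move=> mA; rewrite -[leRHS]mul1e -integral_cst//; apply: ge0_le_integral => //=.
- by move=> x _; rewrite lee_fin uniform_pdf_ge0.
- by apply/measurable_EFinP/measurable_funTS; exact: measurable_uniform_pdf.
- by move=> x _; rewrite lee_fin /uniform_pdf; case: ifP; rewrite ?subr0 ?invr1.
Qed.

Let box_measure s r : 0 <= r ->
  (power_prob unif d (box s r) <= ((2 / h * r) ^+ d)%:E)%E.
Proof.
move=> r0; rewrite (@power_prob_rectangle _ _ _ unif d (fun i =>
  `[tnth s i - r / h, tnth s i + r / h]%classic)); last by move=> i; exact: measurable_itv.
rewrite lee_fin -[d in leRHS]card_ord -prodr_const; apply: ler_prod => i _.
rewrite fine_ge0//= -lee_fin fineK ?fin_num_measure//.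
apply: (le_trans (unif_le _)); first exact: measurable_itv.
rewrite lebesgue_measure_itv/= lte_fin; case: ifPn => _; last first.
  by rewrite lee_fin !mulr_ge0// invr_ge0 ltW.
by rewrite -EFinD lee_fin le_eqVlt; apply/orP; left; apply/eqP; ring.
Qed.

Let cube_measure : power_prob unif d cube = 1%E.
Proof.
rewrite (@power_prob_rectangle _ _ _ unif d (fun=> `[0, 1]%classic)).
  by rewrite big1// => i _; rewrite /unif /= /uniform_prob integral_uniform_pdf1.
by move=> i; exact: measurable_itv.
Qed.

(* Mass distribution principle for the image of the uniform measure on a cube
   under the chart [vec] of the sphere. *)
Lemma hausdorff_sphere_gt0 : (0 < hausdorff d [set: S])%E.
Proof.
apply: (@lt_le_trans _ _ (((2 / h) ^+ d)^-1)%:E).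
  by rewrite lte_fin invr_gt0 exprn_gt0// divr_gt0.
apply: le_trans (hausdorff_pre_le d setT (@ltr01 R)).
apply: le_ereal_inf_tmp => _ [U [UT dU] <-].
pose hit i (s : d.-tuple R) := exists2 cs : cube s, True & U i (Sphere (vec_sphere cs)).
(* A box about one parameter of [U i] that contains all of them: the chart shows [h] times each
   parameter as a coordinate, so parameters of points of [U i] differ by at most
   [diam (U i) / h]. *)
pose B i := if pselect (exists s, hit i s) is left e
  then box (projT1 (cid e)) (fine (diam (U i))) else set0.
have mB i : measurable (B i).
  rewrite /B; case: pselect => // e.
  apply: (@measurable_rectangle _ _ d (fun j =>
    `[tnth (projT1 (cid e)) j - _ / h, tnth (projT1 (cid e)) j + _ / h]%classic)) => j.
  exact: measurable_itv.
have dfin i x : U i x -> diam (U i) = (fine (diam (U i)))%:E.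
  move=> Ux; rewrite fineK// ge0_fin_numE.
    by rewrite (le_lt_trans (dU i))// ltry.
  by rewrite (le_trans _ (diam_ub Ux Ux))// lee_fin mdist_ge0.
have cubeB : cube `<=` \bigcup_i B i.
  move=> t ct; have [i _ Ut] := UT (Sphere (vec_sphere ct)) I.
  exists i => //; rewrite /B; case: pselect => [e|]; last by case; exists t, ct.
  case: (cid e) => /= s [cs _ Us] j.
  have := diam_ub Ut Us; rewrite (dfin _ _ Us) lee_fin => ts.
  have := le_trans (coord_le_mdist _ _ (lift ord0 j)) ts.
  rewrite /coord /= !mxE liftK -mulrBr normrM gtr0_norm// mulrC -ler_pdivlMr//.
  by rewrite ler_norml in_itv/= => /andP[h1 h2]; apply/andP; split; lra.
have Bgauge i : (power_prob unif d (B i) <= ((2 / h) ^+ d)%:E * hausdorff_gauge d (U i))%E.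
  rewrite /B; case: pselect => [e|_]; last first.
    rewrite measure0 mule_ge0//; last exact: hausdorff_gauge_ge0.
    by rewrite lee_fin exprn_ge0// divr_ge0// ltW.
  case: (cid e) => /= s [cs _ Us].
  have r0 : 0 <= fine (diam (U i)).
    by rewrite -lee_fin -(dfin _ _ Us) (le_trans _ (diam_ub Us Us))// lee_fin mdist_ge0.
  apply: (le_trans (box_measure s r0)); rewrite exprMn EFinM /hausdorff_gauge.
  case: asboolP => [U0|_]; first by rewrite U0 in Us.
  by rewrite [in leRHS](dfin _ _ Us) -EFin_expe.
have c0 : 0 < (2 / h) ^+ d by rewrite exprn_gt0// divr_gt0.
rewrite -[leLHS]mule1 lee_pdivrMl// -nneseriesZl//; last first.
  by move=> *; exact: hausdorff_gauge_ge0.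
rewrite -cube_measure; apply: (@le_trans _ _ (\sum_(i <oo) power_prob unif d (B i))%E).
  apply: measure_sigma_subadditive => //.
  apply: (@measurable_rectangle _ (measurableTypeR R) d (fun=> `[0, 1]%classic)) => j.
  exact: measurable_itv.
by apply: lee_nneseries.
Qed.

End sphere_positive.

Lemma hausdorff_pre_fin_cover (R : realType) (M : pointedMetricType R) (k : nat)
    (delta r : R) (I : finType) (U : I -> set M) :
  0 <= r <= delta ->
  (forall x, exists i, U i x) ->
  (forall i x y, U i x -> U i y -> mdist x y <= r) ->
  (hausdorff_pre k delta [set: M] <= (#|I|%:R * r ^+ k)%:E)%E.
Proof.
move=> /andP[r0 rd] UT Ur.
(* The finite cover is continued by empty sets, which have gauge 0 even for [k = 0]. *)
pose V n := if insub n is Some j then U (enum_val (j : 'I_#|I|)) else set0.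
have Vr n x y : V n x -> V n y -> mdist x y <= r.
  by rewrite /V; case: insubP => // j _ _; exact: Ur.
apply: (@le_trans _ _ (\sum_(n <oo) hausdorff_gauge k (V n))%E).
  apply: ereal_inf_lbound; exists V => //; split.
    move=> x _; have [i Ux] := UT x; exists (enum_rank i : nat) => //.
    by rewrite /V valK enum_rankK.
  move=> n; apply: diam_le => x y Vx Vy.
  by rewrite lee_fin (le_trans (Vr _ _ _ Vx Vy)).
rewrite (nneseries_split 0%N #|I|)//; last by move=> *; exact: hausdorff_gauge_ge0.
rewrite add0n eseries0 ?adde0; last first.
  move=> n In _; rewrite /V insubN ?hausdorff_gauge0// -leqNgt//.
apply: (@le_trans _ _ (\sum_(0 <= n < #|I|) (r ^+ k)%:E)%E).
  by apply: lee_sum => n _; apply: gauge_le => // x y; exact: Vr.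
by rewrite sumEFin lee_fin sumr_const_nat subn0 mulr_natl.
Qed.

(** * The sphere has finite Hausdorff measure *)

Section sphere_finite.
Context {R : realType} {d : nat}.
Notation S := (sphere R d).

Let D : R := d.+1%:R.
Let D_gt0 : 0 < D. Proof. by rewrite /D. Qed.
Let D_ge1 : 1 <= D. Proof. by rewrite /D ler1n. Qed.

(** Otherwise the [d.+1] squared coordinates would all be below [1 / d.+1] and could not add up to
    1. *)
Let large_coord (x : S) : exists i, D^-1 <= `|coord i x|.
Proof.
apply/existsP; apply: contraT => /existsPn xi.
have : \sum_i coord i x ^+ 2 < \sum_(i < d.+1) D^-1.
  apply: ltr_sum; first by apply/hasP; exists ord0; rewrite ?mem_index_enum.
  move=> i _; have := xi i; rewrite -ltNge => xD.
  rewrite -(real_normK (num_real _)) expr2.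
  apply: (@le_lt_trans _ _ (1 * `|coord i x|)); last by rewrite mul1r.
  rewrite ler_wpM2r// (le_trans (ltW xD))// invf_le1//.
rewrite sumr_const card_ord -[X in _ < X]mulr_natl divff ?gt_eqF//.
have -> : \sum_i coord i x ^+ 2 = dot x x.
  by apply: eq_bigr => i _; rewrite /coord expr2.
by rewrite dot_sphere1 ltxx.
Qed.

(** A label records a coordinate of size at least [1 / D], its sign, and the position of each other
    coordinate on a grid of mesh [1 / (m + 1)] in [-1, 1]. The extra slot [2 * m.+1] holds the
    endpoint 1. *)
Let cell m : Type := ('I_d.+1 * bool * {ffun 'I_d -> 'I_(2 * m.+1).+1})%type.

Let slot m (u : R) : nat := Num.truncn ((u + 1) * m.+1%:R).

Let U m (c : cell m) : set S := [set x | [/\ D^-1 <= (-1) ^+ c.1.2 * coord c.1.1 x &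
  forall j, slot m (coord (lift c.1.1 j) x) = c.2 j]].

Let coord_le1 (x : S) i : -1 <= coord i x <= 1.
Proof.
rewrite -ler_norml -(@ler_pXn2r _ 2)// ?nnegrE// real_normK ?num_real// expr1n.
rewrite -(dot_sphere1 x) /dot (bigD1 i)//= -expr2 lerDl.
by apply: sumr_ge0 => j _; rewrite -expr2 sqr_ge0.
Qed.

Let U_cover m x : exists c, U (m := m) c x.
Proof.
have [i xi] := large_coord x.
exists (i, coord i x < 0, [ffun j => inord (slot m (coord (lift i j) x))]); split => /=.
  by move: xi; rewrite mulr_sign; case: ltP => h; [rewrite ltr0_norm|rewrite ger0_norm].
move=> j; rewrite ffunE inordK// ltnS /slot.
have /andP[x0 x1] := coord_le1 x (lift i j).
rewrite -ltnS truncn_lt_nat; last by rewrite mulr_ge0//; lra.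
apply: (@le_lt_trans _ _ (2 * m.+1%:R)); first by rewrite ler_wpM2r//; lra.
by rewrite -natrM ltr_nat.
Qed.

Let slot_close m u v : -1 <= u -> -1 <= v -> slot m u = slot m v ->
  `|u - v| <= m.+1%:R^-1.
Proof.
move=> u1 v1; rewrite /slot.
have : 0 < m.+1%:R :> R by [].
move: (m.+1%:R : R) => M M0.
have /truncn_itv : 0 <= (u + 1) * M by rewrite mulr_ge0//; lra.
have /truncn_itv : 0 <= (v + 1) * M by rewrite mulr_ge0//; lra.
move=> /andP[v2 v3] /andP[u2 u3] uv; rewrite uv in u2 u3.
rewrite -[leRHS]mul1r ler_pdivlMr// -[X in _ * X]gtr0_norm// -normrM mulrBl.
rewrite ler_norml -natr1 in u3 v3 *; apply/andP; split; lra.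
Qed.

(** The grid controls every coordinate but the [i]-th. For that one, the equation of the sphere
    bounds the difference of squares, and dividing by the sum, which is at least [2 / D] because
    both terms are large and of the same sign, bounds the difference. *)
Let U_diam m c x y : U (m := m) c x -> U c y -> mdist x y <= 2 * D ^+ 3 / m.+1%:R.
Proof.
case: c => [[i b] c] [/= xi xc] [/= yi yc].
set e : R := m.+1%:R^-1.
have e0 : 0 <= e by rewrite invr_ge0.
have le j : `|coord (lift i j) x - coord (lift i j) y| <= e.
  apply: slot_close; last by rewrite xc yc.
    by have /andP[] := coord_le1 x (lift i j).
  by have /andP[] := coord_le1 y (lift i j).
have lei : `|coord i x - coord i y| <= D ^+ 2 * e.
  have sq : `|coord i x ^+ 2 - coord i y ^+ 2| <= 2 * D * e.
    have cE (z : S) : coord i z ^+ 2 = 1 - \sum_(j | j != i) coord j z ^+ 2.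
      have : dot z z = coord i z ^+ 2 + \sum_(j | j != i) coord j z ^+ 2.
        by rewrite /dot (bigD1 i)//=; congr (_ + _); apply: eq_bigr => j _; rewrite expr2.
      by rewrite dot_sphere1 => ->; rewrite addrK.
    have E s t : 1 - s - (1 - t) = t - s :> R by ring.
    rewrite !cE E -sumrB.
    apply: (le_trans (ler_norm_sum _ _ _)).
    apply: (@le_trans _ _ (\sum_(j < d.+1) (2 * e))); last first.
      by rewrite sumr_const card_ord -[leLHS]mulr_natl mulrCA mulrA.
    rewrite [leRHS](bigID (fun j => j != i))/= -[leLHS]addr0.
    apply: lerD; last by apply: sumr_ge0 => *; rewrite mulr_ge0.
    apply: ler_sum => j; rewrite eq_sym => /unlift_some[k -> _].
    rewrite subr_sqr normrM mulrC ler_pM//; last by rewrite distrC.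
    rewrite (le_trans (ler_normD _ _))//.
    have : `|coord (lift i k) x| <= 1 by rewrite ler_norml.
    have : `|coord (lift i k) y| <= 1 by rewrite ler_norml.
    lra.
  have s2 : 2 * D^-1 <= `|coord i x + coord i y|.
    have -> : `|coord i x + coord i y| = `|(-1) ^+ b * (coord i x + coord i y)|.
      by rewrite normrMsign.
    by rewrite (le_trans _ (ler_norm _))// mulrDr mulr_natl mulr2n lerD.
  have : `|coord i x - coord i y| * (2 * D^-1) <= 2 * D * e.
    apply: le_trans sq; rewrite subr_sqr normrM.
    by rewrite ler_wpM2l.
  rewrite mulrA ler_pdivrMr// => h2.
  rewrite (_ : 2 * D * e * D = D ^+ 2 * e * 2) in h2; last by ring.
  by rewrite ler_pM2r in h2.
rewrite (_ : 2 * D ^+ 3 / m.+1%:R = 2 * d.+1%:R * (D ^+ 2 * e)); last first.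
  by rewrite /D /e; ring.
apply: mdist_le_coord => [|j]; first by rewrite mulr_ge0// exprn_ge0// ltW.
have [k|] := unliftP i j => -> //.
by rewrite (le_trans (le k))// ler_peMl// exprn_ege1.
Qed.

Lemma hausdorff_sphere_lty : (hausdorff d [set: S] < +oo)%E.
Proof.
(* Number of cells times the [d]-th power of their diameter; [(2 * m.+1).+1 <= 3 * m.+1] makes the
   bound independent of [m]. *)
pose K : R := (d.+1 * 2)%:R * (2 * D ^+ 3 * 3) ^+ d.
apply: (@le_lt_trans _ _ K%:E); last by rewrite ltry.
apply: ge_ereal_sup => _ [delta /= delta0 <-].
pose m := Num.truncn (2 * D ^+ 3 / delta).
pose r := 2 * D ^+ 3 / m.+1%:R.
have r0 : 0 <= r by rewrite divr_ge0// mulr_ge0// exprn_ge0// ltW.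
have rd : r <= delta.
  by rewrite ler_pdivrMr// [delta * _]mulrC -ler_pdivrMr// ltW// truncnS_gt.
apply: (le_trans (hausdorff_pre_fin_cover d (delta := delta) (r := r) _ (U_cover m) (@U_diam m))).
  by rewrite r0.
rewrite lee_fin !card_prod card_bool card_ord card_ffun !card_ord natrM -mulrA.
rewrite ler_wpM2l// natrX -exprMn lerXn2r ?nnegrE//; first by rewrite mulr_ge0.
  by rewrite !mulr_ge0// exprn_ge0// ltW.
rewrite /r mulrCA ler_wpM2l//; first by rewrite mulr_ge0// exprn_ge0// ltW.
rewrite ler_pdivrMr// -natrM ler_nat.
by rewrite -[X in (X <= _)%N]add1n [leqRHS]mulSn leq_add2r.
Qed.

End sphere_finite.

(** * The uniform measure under Lipschitz maps and isometries *)

Section uniform_sphere.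
Context {R : realType} {d : nat}.
Notation S := (sphere R d).
Notation mu := (uniform_sphere R d).

Lemma hausdorff_sphere_fin_num : hausdorff d [set: S] \is a fin_num.
Proof. by rewrite ge0_fin_numE ?hausdorff_sphere_lty// ltW// hausdorff_sphere_gt0. Qed.

Lemma uniform_sphereE (A : set S) :
  mu A = (hausdorff d A * (fine (hausdorff d [set: S]))^-1%:E)%E.
Proof.
rewrite /uniform_sphere /= /mnormalize /hausdorff_measure /=.
rewrite gt_eqF ?hausdorff_sphere_gt0// lt_eqF ?hausdorff_sphere_lty//.
Qed.

Let c_gt0 : 0 < (fine (hausdorff d [set: S]))^-1.
Proof.
rewrite invr_gt0 -lte_fin fineK ?hausdorff_sphere_fin_num//.
exact: hausdorff_sphere_gt0.
Qed.

(** As [f] is onto, [A] is the image of its preimage, so this is [hausdorff_lipschitz] divided by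
    the total mass. *)
Lemma uniform_sphere_lipschitz (f : S -> S) (L : R) (A : set S) : 0 < L ->
  (forall x y, mdist (f x) (f y) <= L * mdist x y) ->
  (forall y, exists x, f x = y) ->
  (mu A <= (L ^+ d)%:E * mu (f @^-1` A))%E.
Proof.
move=> L0 fL fsurj; rewrite !uniform_sphereE muleA lee_pmul2r//.
have {1}-> : A = f @` (f @^-1` A).
  apply/seteqP; split => [y Ay|_ [x fx <-]//].
  by have [x fxy] := fsurj y; exists x => //=; rewrite fxy.
exact: hausdorff_lipschitz.
Qed.

Lemma mdist_dot (x y x' y' : S) : dot x y = dot x' y' -> mdist x y = mdist x' y'.
Proof. by move=> xy; congr acos. Qed.

(** The Lipschitz bound with constant 1, for [f] and for its inverse [g]. *)
Lemma uniform_sphere_isometry (f g : S -> S) (A : set S) :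
  (forall x y, dot (f x) (f y) = dot x y) -> cancel f g -> cancel g f ->
  mu (f @^-1` A) = mu A.
Proof.
move=> fdot fK gK; apply/eqP; rewrite eq_le; apply/andP; split.
  have gL x y : mdist (g x) (g y) <= 1 * mdist x y.
    by rewrite mul1r (@mdist_dot _ _ x y)// -fdot !gK.
  have := @uniform_sphere_lipschitz g 1 (f @^-1` A) ltr01 gL (fun y => ex_intro _ (f y) (fK y)).
  by rewrite expr1n mul1e -comp_preimage (_ : f \o g = id) //; exact/funext.
have fL x y : mdist (f x) (f y) <= 1 * mdist x y.
  by rewrite mul1r (@mdist_dot _ _ x y).
have := @uniform_sphere_lipschitz f 1 A ltr01 fL (fun y => ex_intro _ (g y) (gK y)).
by rewrite expr1n mul1e.
Qed.

Lemma mean_preserving_isometry (f g : S -> S) :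
  measurable_fun [set: borel S] (f : borel S -> borel S) ->
  (forall x y, dot (f x) (f y) = dot x y) -> cancel f g -> cancel g f ->
  mean_preserving mu (f : borel S -> borel S).
Proof.
move=> mf fdot fK gK; split => // h bh; apply/esym; apply: mean_comp => // A mA.
by rewrite (uniform_sphere_isometry A fdot fK gK).
Qed.

Lemma uniform_sphere_set1 (x : S) : (0 < d)%N -> mu [set x] = 0%E.
Proof.
move=> d0; rewrite uniform_sphereE.
suff -> : hausdorff d [set x] = 0%E by rewrite mul0e.
apply/eqP; rewrite eq_le outer_measure_ge0 andbT.
apply: ge_ereal_sup => _ [delta /= delta0 <-].
apply: (@le_trans _ _ (\sum_(i <oo) hausdorff_gauge d
    ((fun i : nat => if i is 0%N then [set x] else set0) i))%E).
  apply: ereal_inf_lbound; eexists; last by []; split.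
    by move=> _ ->; exists 0%N.
  case=> [|i]; last by rewrite diam_set0 leNye.
  by apply: diam_le => _ _ -> ->; rewrite mdistxx lee_fin ltW.
rewrite nneseries_recl//; last by move=> *; exact: hausdorff_gauge_ge0.
rewrite eseries0 ?adde0; last by move=> [|i]// _ _; rewrite hausdorff_gauge0.
rewrite (_ : 0 = (0 ^+ d)%:E)%E; last by rewrite expr0n gtn_eqF.
by apply: gauge_le => // _ _ -> ->; rewrite mdistxx.
Qed.

End uniform_sphere.

(** * Doubling and folding maps *)

Section sphere_maps.
Context {R : realType} {d : nat}.
Notation S := (sphere R d).
Implicit Types (x y v w : S) (c s : R).

Lemma coord_inj x y : (forall i, coord i x = coord i y) -> x = y.
Proof. by move=> xy; apply/val_inj/rowP => i; exact: xy. Qed.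

Lemma dotE x y : dot x y = \sum_i coord i x * coord i y.
Proof. by []. Qed.

Lemma dot_inj x y : dot x y = 1 -> x = y.
Proof.
by move=> xy; apply: mdist_positivity; rewrite -(mdistxx x); apply: mdist_dot; rewrite xy dot_sphere1.
Qed.

(** Total, with a default value outside the sphere, so that maps can be given by formulas for
    vectors; the unit norm is proved afterwards. *)
Definition to_sphere (u : 'rV[R]_d.+1) : S := insubd (point : S) u.

Lemma to_sphereK u : dot u u = 1 -> sphere_val (to_sphere u) = u.
Proof. by move=> /eqP u1; rewrite /to_sphere -[LHS]/(val _) insubdK. Qed.

(** Reflection in the hyperplane orthogonal to [v]. *)
Definition refl v x : S :=
  to_sphere (sphere_val x + (- (2 * dot v x)) *: sphere_val v).

Lemma reflE v x :
  sphere_val (refl v x) = sphere_val x + (- (2 * dot v x)) *: sphere_val v.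
Proof.
rewrite to_sphereK// !(dotDl, dotDr, dotZl, dotZr) !dot_sphere1 (dotC x v).
by ring.
Qed.

Lemma dot_refl v w x y : dot (refl v x) (refl w y) =
  dot x y - 2 * dot v x * dot v y - 2 * dot w y * dot w x +
  4 * dot v x * dot w y * dot v w.
Proof.
rewrite !reflE !(dotDl, dotDr, dotZl, dotZr) (dotC x w); ring.
Qed.

Lemma dot_refl_isometry v x y : dot (refl v x) (refl v y) = dot x y.
Proof. by rewrite dot_refl dot_sphere1; ring. Qed.

Lemma reflK v : involutive (refl v).
Proof.
move=> x; apply/val_inj; rewrite /= !reflE !(dotDr, dotZr) dot_sphere1.
rewrite -addrA -scalerDl [X in X *: _](_ : _ = 0) ?scale0r ?addr0//.
by ring.
Qed.

Lemma refl_refl v w x : refl v (refl w (refl v x)) = refl (refl v w) x.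
Proof.
apply/val_inj; rewrite /= !reflE !(dotDl, dotDr, dotZl, dotZr) dot_sphere1.
rewrite !(scalerDr, scalerDl, scalerA) (dotC w v).
by apply/rowP => i; rewrite !mxE; ring.
Qed.

(** The left side is [2 (dot v x - dot w x)^2 + 4 (dot v x) (dot w x) (1 - dot v w)]. By
    Cauchy-Schwarz for [v - w] and [x] the first term is at most [4 (1 - dot v w)], and so is the
    second. *)
Lemma refl_lipschitz v w x :
  1 - dot (refl v x) (refl w x) <= 8 * (1 - dot v w).
Proof.
rewrite dot_refl dot_sphere1.
have := dot_CauchySchwarz (sphere_val v - sphere_val w) (sphere_val x).
rewrite -scaleN1r !(dotDl, dotDr, dotZl, dotZr) !dot_sphere1 (dotC w v).
have /andP[_ vw] := dot_sphere_bound v w.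
have vx : `|dot v x| <= 1 by rewrite ler_norml dot_sphere_bound.
have wx : `|dot w x| <= 1 by rewrite ler_norml dot_sphere_bound.
have : dot v x * dot w x * (1 - dot v w) <= 1 * (1 - dot v w).
  apply: ler_wpM2r; first by rewrite subr_ge0.
  by rewrite (le_trans (ler_norm _))// normrM mulr_ile1.
lra.
Qed.

End sphere_maps.

(** * Rotation, angle doubling and folding in a coordinate plane *)

Section plane_maps.
Context {R : realType} {d : nat}.
Notation S := (sphere R d).
Hypothesis d_gt0 : (0 < d)%N.
Implicit Types (x y v w : S) (c s : R).

Notation i0 := (ord0 : 'I_d.+1).
Notation i1 := (ord_max : 'I_d.+1).
Notation p := (coord i1).
Notation q := (coord i0).

Let i10 : i1 == i0 = false.
Proof. by rewrite -val_eqE /= gtn_eqF. Qed.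

Definition plane_rest x y := \sum_(i | (i != i0) && (i != i1)) coord i x * coord i y.

Lemma dot_plane x y : dot x y = q x * q y + p x * p y + plane_rest x y.
Proof. by rewrite dotE (bigD1 i0)//= (bigD1 i1) ?i10//= addrA. Qed.

Lemma plane_rest_le x y : 2 * plane_rest x y <= plane_rest x x + plane_rest y y.
Proof.
rewrite /plane_rest mulr_sumr -big_split; apply: ler_sum => i _ /=.
by have := sqr_ge0 (coord i x - coord i y); rewrite sqrrB; lra.
Qed.

Definition replace x s c : S := to_sphere
  (\row_i if i == i0 then s else if i == i1 then c else coord i x).

Section replace_coord.
Variables (x : S) (s c : R).
Hypothesis sc : s ^+ 2 + c ^+ 2 = q x ^+ 2 + p x ^+ 2.

Let replaceE : sphere_val (replace x s c) =
  \row_i if i == i0 then s else if i == i1 then c else coord i x.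
Proof.
rewrite to_sphereK// /dot (bigD1 i0)//= (bigD1 i1) ?i10//= !mxE i10 !eqxx.
rewrite (eq_bigr (fun i => coord i x * coord i x)); last first.
  by move=> i /andP[/negbTE n0 /negbTE n1]; rewrite !mxE n0 n1.
by rewrite addrA -!expr2 sc -(dot_sphere1 x) dot_plane !expr2.
Qed.

Lemma q_replace : q (replace x s c) = s.
Proof. by rewrite /coord replaceE mxE eqxx. Qed.

Lemma p_replace : p (replace x s c) = c.
Proof. by rewrite /coord replaceE mxE eqxx i10. Qed.

Lemma rest_replace i : i != i0 -> i != i1 -> coord i (replace x s c) = coord i x.
Proof. by move=> /negbTE n0 /negbTE n1; rewrite {1}/coord replaceE mxE n0 n1. Qed.

Lemma replace_eq y : q y = s -> p y = c ->
  (forall i, i != i0 -> i != i1 -> coord i y = coord i x) -> replace x s c = y.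
Proof.
move=> qy py ry; apply: coord_inj => i.
have [->|n0] := eqVneq i i0; first by rewrite q_replace.
have [->|n1] := eqVneq i i1; first by rewrite p_replace.
by rewrite rest_replace// ry.
Qed.

End replace_coord.

Definition rho x := Num.sqrt (q x ^+ 2 + p x ^+ 2).
(* [angc x] and [angs x] are the cosine and sine of the angle of the projection
   of [x] to the plane; the angle is 0 when that projection vanishes. *)
Definition angc x := if rho x == 0 then 1 else p x / rho x.
Definition angs x := q x / rho x.

Lemma sqr_rho x : rho x ^+ 2 = q x ^+ 2 + p x ^+ 2.
Proof. by rewrite sqr_sqrtr// addr_ge0// sqr_ge0. Qed.

Lemma rho_ge0 x : 0 <= rho x.
Proof. exact: sqrtr_ge0. Qed.

Let rho0 x : rho x = 0 -> q x = 0 /\ p x = 0.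
Proof.
move=> r0; have := sqr_rho x; rewrite r0 expr0n/= => /esym/eqP.
by rewrite paddr_eq0 ?sqr_ge0// !sqrf_eq0 => /andP[/eqP-> /eqP->].
Qed.

Lemma p_polar x : p x = rho x * angc x.
Proof.
rewrite /angc; case: eqVneq => [r0|r0]; first by rewrite r0 mul0r (rho0 r0).2.
by rewrite mulrC divfK.
Qed.

Lemma q_polar x : q x = rho x * angs x.
Proof.
have [r0|r0] := eqVneq (rho x) 0; first by rewrite r0 mul0r (rho0 r0).1.
by rewrite /angs mulrC divfK.
Qed.

Lemma ang_unit x : angc x ^+ 2 + angs x ^+ 2 = 1.
Proof.
rewrite /angc /angs; case: eqVneq => [->|r0].
  by rewrite invr0 mulr0 expr1n expr0n addr0.
by rewrite !exprMn -mulrDl addrC -sqr_rho exprVn divff// sqrf_eq0.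
Qed.

(** For [c ^+ 2 + s ^+ 2 = 1], the rotation of the plane by the angle with cosine [c] and sine [s],
    where angles are measured from the [p]-axis towards the [q]-axis. *)
Definition rot c s x := replace x (s * p x + c * q x) (c * p x - s * q x).

Section rotations.
Variables (c s : R).
Hypothesis cs1 : c ^+ 2 + s ^+ 2 = 1.

Let rot_norm x : (s * p x + c * q x) ^+ 2 + (c * p x - s * q x) ^+ 2 =
  q x ^+ 2 + p x ^+ 2.
Proof.
transitivity ((c ^+ 2 + s ^+ 2) * (q x ^+ 2 + p x ^+ 2)); last by rewrite cs1 mul1r.
by ring.
Qed.

Lemma q_rot x : q (rot c s x) = s * p x + c * q x.
Proof. exact: q_replace. Qed.

Lemma p_rot x : p (rot c s x) = c * p x - s * q x.
Proof. exact: p_replace. Qed.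

Lemma rest_rot x i : i != i0 -> i != i1 -> coord i (rot c s x) = coord i x.
Proof. exact: rest_replace. Qed.

Lemma rot_eq x y : q y = s * p x + c * q x -> p y = c * p x - s * q x ->
  (forall i, i != i0 -> i != i1 -> coord i y = coord i x) -> rot c s x = y.
Proof. exact: replace_eq. Qed.

Lemma rho_rot x : rho (rot c s x) = rho x.
Proof. by rewrite /rho q_rot p_rot rot_norm. Qed.

Lemma angc_rot x : rho x != 0 -> angc (rot c s x) = c * angc x - s * angs x.
Proof.
move=> r0; rewrite /angc rho_rot (negbTE r0) p_rot /angs; by field.
Qed.

Lemma angs_rot x : rho x != 0 -> angs (rot c s x) = s * angc x + c * angs x.
Proof.
move=> r0; rewrite /angc /angs rho_rot (negbTE r0) q_rot; by field.
Qed.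

Lemma dot_rot x y : dot (rot c s x) (rot c s y) = dot x y.
Proof.
rewrite !dot_plane !q_rot !p_rot [X in _ + X](_ : _ = plane_rest x y).
  congr (_ + _); rewrite -[RHS]mul1r -cs1; by ring.
by apply: eq_bigr => i /andP[n0 n1]; rewrite !rest_rot.
Qed.

End rotations.

Lemma rot_rot c s c' s' x : c ^+ 2 + s ^+ 2 = 1 -> c' ^+ 2 + s' ^+ 2 = 1 ->
  rot c s (rot c' s' x) = rot (c * c' - s * s') (s * c' + c * s') x.
Proof.
move=> h h'; apply: rot_eq => //.
- rewrite q_rot ?p_rot ?q_rot//; first by ring.
  by transitivity ((c ^+ 2 + s ^+ 2) * (c' ^+ 2 + s' ^+ 2)); [ring|rewrite h h' mulr1].
- rewrite p_rot ?p_rot ?q_rot//; first by ring.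
  by transitivity ((c ^+ 2 + s ^+ 2) * (c' ^+ 2 + s' ^+ 2)); [ring|rewrite h h' mulr1].
- move=> i n0 n1; rewrite !rest_rot//.
  by transitivity ((c ^+ 2 + s ^+ 2) * (c' ^+ 2 + s' ^+ 2)); [ring|rewrite h h' mulr1].
Qed.

Lemma rot10 x : rot 1 0 x = x.
Proof.
by apply: rot_eq => //; rewrite ?expr1n ?expr0n ?addr0// !(mul0r, mul1r, add0r, subr0).
Qed.

Lemma rotK c s : c ^+ 2 + s ^+ 2 = 1 -> cancel (rot c s) (rot c (- s)).
Proof.
move=> h x; rewrite rot_rot ?sqrrN//.
have -> : c * c - - s * s = 1 by rewrite -h; ring.
have -> : - s * c + c * s = 0 by ring.
by rewrite rot10.
Qed.

(** Rotating [x] by its own angle doubles that angle and keeps the length of the projection and all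
    other coordinates. *)
Definition double x := rot (angc x) (angs x) x.

Lemma q_double x : q (double x) = rho x * (2 * angc x * angs x).
Proof. by rewrite q_rot ?ang_unit// p_polar q_polar; ring. Qed.

Lemma p_double x : p (double x) = rho x * (angc x ^+ 2 - angs x ^+ 2).
Proof. by rewrite p_rot ?ang_unit// p_polar q_polar; ring. Qed.

Lemma rest_double x i : i != i0 -> i != i1 -> coord i (double x) = coord i x.
Proof. exact/rest_rot/ang_unit. Qed.

Lemma double_eq x y : q y = rho x * (2 * angc x * angs x) ->
  p y = rho x * (angc x ^+ 2 - angs x ^+ 2) ->
  (forall i, i != i0 -> i != i1 -> coord i y = coord i x) -> double x = y.
Proof.
move=> qy py ry; apply: coord_inj => i.
have [->|n0] := eqVneq i i0; first by rewrite q_double -qy.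
have [->|n1] := eqVneq i i1; first by rewrite p_double -py.
by rewrite rest_double// ry.
Qed.

(** The rotation angle adds to the angle of [x], so doubling counts it twice. If the projection
    vanishes, the plane coordinates on both sides are 0. *)
Lemma double_rot c s x : c ^+ 2 + s ^+ 2 = 1 ->
  double (rot c s x) = rot (c ^+ 2 - s ^+ 2) (2 * c * s) (double x).
Proof.
move=> h.
have h2 : (c ^+ 2 - s ^+ 2) ^+ 2 + (2 * c * s) ^+ 2 = 1.
  by transitivity ((c ^+ 2 + s ^+ 2) ^+ 2); [ring|rewrite h expr1n].
apply: double_eq.
- rewrite q_rot// q_double p_double rho_rot//.
  have [->|r0] := eqVneq (rho x) 0; first by rewrite !mul0r !mulr0 addr0.
  by rewrite angc_rot// angs_rot//; ring.
- rewrite p_rot// q_double p_double rho_rot//.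
  have [->|r0] := eqVneq (rho x) 0; first by rewrite !mul0r !mulr0 subr0.
  by rewrite angc_rot// angs_rot//; ring.
- by move=> i n0 n1; rewrite rest_rot// rest_double// rest_rot.
Qed.

(** Let [e] be the cosine of the angle between the two projections, of lengths [r] and [r'].
    Doubling replaces [e] by [2 e^2 - 1 = 4 e - 3 + 2 (1 - e)^2]; what remains is
    [r r' + plane_rest x y <= 1], the arithmetic-geometric mean inequality. *)
Lemma double_lipschitz x y : 1 - dot (double x) (double y) <= 2 ^+ 2 * (1 - dot x y).
Proof.
have restE : plane_rest (double x) (double y) = plane_rest x y.
  by apply: eq_bigr => i /andP[n0 n1]; rewrite !rest_double.
have hx := dot_sphere1 x; have hy := dot_sphere1 y.
rewrite dot_plane -!expr2 -sqr_rho in hx; rewrite dot_plane -!expr2 -sqr_rho in hy.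
rewrite !dot_plane restE !q_double !p_double.
have rest := plane_rest_le x y.
rewrite !(q_polar, p_polar).
set a := angc x; set b := angs x; set a' := angc y; set b' := angs y.
set r := rho x in hx *; set r' := rho y in hy *.
pose e := a * a' + b * b'.
have r0 : 0 <= r by exact: rho_ge0.
have r0' : 0 <= r' by exact: rho_ge0.
have e2 : (a ^+ 2 - b ^+ 2) * (a' ^+ 2 - b' ^+ 2) + (2 * a * b) * (2 * a' * b') =
    2 * e ^+ 2 - 1.
  transitivity (2 * e ^+ 2 - (a ^+ 2 + b ^+ 2) * (a' ^+ 2 + b' ^+ 2)).
    by rewrite /e; ring.
  by rewrite !ang_unit mulr1.
have -> : r * (2 * a * b) * (r' * (2 * a' * b')) +
    r * (a ^+ 2 - b ^+ 2) * (r' * (a' ^+ 2 - b' ^+ 2)) = r * r' * (2 * e ^+ 2 - 1).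
  by rewrite -e2; ring.
have -> : r * b * (r' * b') + r * a * (r' * a') = r * r' * e by rewrite /e; ring.
have s1 := sqr_ge0 (r - r').
have s2 : 0 <= r * r' * (1 - e) ^+ 2.
  by apply: mulr_ge0; [exact: mulr_ge0|exact: sqr_ge0].
have -> : r * r' * (2 * e ^+ 2 - 1) =
  2 * (r * r' * (1 - e) ^+ 2) + 4 * (r * r' * e) - 3 * (r * r') by ring.
rewrite sqrrB in s1.
lra.
Qed.

Definition flip x := refl (point : S) x.

Let coord_point i : coord i (point : S) = (i == i0)%:R.
Proof. by rewrite /coord /= mxE eqxx. Qed.

Let dot_point x : dot (point : S) x = q x.
Proof.
rewrite dotE (bigD1 i0)//= coord_point eqxx mul1r big1 ?addr0// => i /negbTE n0.
by rewrite coord_point n0 mul0r.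
Qed.

Let coord_flip i x : coord i (flip x) = coord i x - 2 * q x * (i == i0)%:R.
Proof.
by rewrite {1}/coord /flip reflE dot_point !mxE eqxx mulNr.
Qed.

Lemma q_flip x : q (flip x) = - q x.
Proof. by rewrite coord_flip eqxx mulr1n; ring. Qed.

Lemma p_flip x : p (flip x) = p x.
Proof. by rewrite coord_flip i10 mulr0 subr0. Qed.

Lemma rest_flip x i : i != i0 -> i != i1 -> coord i (flip x) = coord i x.
Proof. by move=> /negbTE n0 _; rewrite coord_flip n0 mulr0 subr0. Qed.

Lemma double_flip x : double (flip x) = flip (double x).
Proof.
have rf : rho (flip x) = rho x by rewrite /rho q_flip p_flip sqrrN.
apply: double_eq.
- by rewrite q_flip q_double rf /angc /angs rf q_flip p_flip; ring.
- by rewrite p_flip p_double rf /angc /angs rf q_flip p_flip; ring.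
- by move=> i n0 n1; rewrite !rest_flip// rest_double.
Qed.

(** The half turn of the plane: only [p] and [q] change sign. *)
Definition antipode x := rot (-1) 0 x.

Let m10 : (-1) ^+ 2 + 0 ^+ 2 = 1 :> R.
Proof. by rewrite sqrrN expr1n expr0n addr0. Qed.

Lemma double_antipode x : double (antipode x) = double x.
Proof. by rewrite double_rot// expr0n sqrrN expr1n subr0 mulr0 rot10. Qed.

Definition fold x := replace x `|q x| (p x).

Let fold_norm x : `|q x| ^+ 2 + p x ^+ 2 = q x ^+ 2 + p x ^+ 2.
Proof. by rewrite real_normK ?num_real. Qed.

Lemma fold_pos x : 0 <= q x -> fold x = x.
Proof. by move=> q0; apply: replace_eq => //; rewrite ger0_norm. Qed.

Lemma fold_neg x : q x <= 0 -> fold x = flip x.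
Proof.
move=> q0; apply: replace_eq => //; first by rewrite q_flip ler0_norm.
  by rewrite p_flip.
exact: rest_flip.
Qed.

Lemma dot_fold x y : dot x y <= dot (fold x) (fold y).
Proof.
rewrite !dot_plane !q_replace// !p_replace//.
rewrite [X in _ <= _ + X](_ : _ = plane_rest x y); last first.
  by apply: eq_bigr => i /andP[n0 n1]; rewrite !rest_replace.
by rewrite !lerD2r -normrM ler_norm.
Qed.

Definition fold_double x := double (fold x).

Lemma fold_double_lipschitz x y :
  1 - dot (fold_double x) (fold_double y) <= 2 ^+ 2 * (1 - dot x y).
Proof.
apply: (le_trans (double_lipschitz _ _)).
by rewrite ler_wpM2l ?sqr_ge0// lerD2l lerN2 dot_fold.
Qed.

(** A point and its half turn have opposite [q], so [fold] fixes one and flips the other; [double]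
    commutes with [flip] and identifies the two. *)
Lemma fold_double_pair x :
  (fold_double x = double x /\ fold_double (antipode x) = flip (double x)) \/
  (fold_double x = flip (double x) /\ fold_double (antipode x) = double x).
Proof.
have qa : q (antipode x) = - q x by rewrite q_rot// mul0r add0r mulN1r.
rewrite /fold_double; have [q0|q0] := leP 0 (q x); [left|right].
  rewrite fold_pos// fold_neg; last by rewrite qa oppr_le0.
  by rewrite double_flip double_antipode.
rewrite fold_neg ?ltW// fold_pos; last by rewrite qa oppr_ge0 ltW.
by rewrite double_flip double_antipode.
Qed.

(** Turn the unit vector at the angle of [x] in the plane by a right angle. *)
Lemma exists_orthogonal x : exists v, dot v x = 0.
Proof.
pose u : 'rV[R]_d.+1 :=
  \row_i if i == i0 then angc x else if i == i1 then - angs x else 0.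
have rest0 (y : 'rV[R]_d.+1) : \sum_(i | (i != i0) && (i != i1)) u 0 i * y 0 i = 0.
  by rewrite big1// => i /andP[/negbTE n0 /negbTE n1]; rewrite mxE n0 n1 mul0r.
exists (to_sphere u); rewrite to_sphereK; last first.
  rewrite /dot (bigD1 i0)//= (bigD1 i1) ?i10//= rest0 !mxE i10 !eqxx.
  by rewrite mulrNN addr0 -!expr2 ang_unit.
rewrite /dot (bigD1 i0)//= (bigD1 i1) ?i10//= rest0 !mxE i10 !eqxx addr0.
by rewrite -/(coord i0 x) -/(coord i1 x) q_polar p_polar; ring.
Qed.

(** For distinct points [v] is the normalised difference [x - y]; for equal points any [v]
    orthogonal to [x] works. *)
Lemma refl_transitive x y : exists v, refl v x = y.
Proof.
have [<-|xy] := eqVneq x y.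
  have [v vx] := exists_orthogonal x.
  by exists v; apply/val_inj; rewrite /= reflE vx mulr0 oppr0 scale0r addr0.
have e0 : 0 < 2 * (1 - dot x y).
  rewrite mulr_gt0// subr_gt0 lt_neqAle (andP (dot_sphere_bound x y)).2 andbT.
  by apply: contra xy => /eqP/dot_inj ->.
pose n := Num.sqrt (2 * (1 - dot x y)).
have n0 : n != 0 by rewrite gt_eqF// sqrtr_gt0.
have n2 : n ^+ 2 = 2 * (1 - dot x y) by rewrite sqr_sqrtr// ltW.
pose u := n^-1 *: (sphere_val x + (-1) *: sphere_val y).
have uu : dot u u = 1.
  rewrite /u !(dotDl, dotDr, dotZl, dotZr) !dot_sphere1 (dotC y x).
  transitivity (n ^- 2 * (2 * (1 - dot x y))); first by rewrite -exprVn; ring.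
  by rewrite -n2 mulVf// sqrf_eq0.
exists (to_sphere u); apply/val_inj; rewrite /= reflE to_sphereK//.
rewrite /u !(dotDl, dotZl) dot_sphere1 (dotC y x) scalerA.
rewrite [X in X *: _](_ : _ = - 1).
  by rewrite scaleN1r scaleN1r opprB addrC subrK.
rewrite mulN1r mulNr; congr (- _).
transitivity (n ^- 2 * (2 * (1 - dot x y))); first by rewrite -exprVn; ring.
by rewrite -n2 mulVf// sqrf_eq0.
Qed.

Lemma half_angle c s : c ^+ 2 + s ^+ 2 = 1 ->
  exists c' s', [/\ c' ^+ 2 + s' ^+ 2 = 1, c' ^+ 2 - s' ^+ 2 = c & 2 * c' * s' = s].
Proof.
move=> cs.
have c1 : c ^+ 2 <= 1 by rewrite -cs lerDl sqr_ge0.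
have : `|c| <= 1 by rewrite -(@ler_pXn2r _ 2)// ?nnegrE// real_normK ?num_real// expr1n.
rewrite ler_norml => /andP[cl cu].
pose c' := Num.sqrt ((1 + c) / 2).
have c2 : c' ^+ 2 = (1 + c) / 2 by rewrite sqr_sqrtr//; lra.
(* For a straight angle the half-angle cosine is 0 and cannot be divided by; half of it is the right
   angle. *)
have [c0|c0] := eqVneq c' 0.
  have cN : c = -1 by rewrite c0 expr0n/= in c2; lra.
  exists 0, 1; rewrite cN; split; [ring|ring|].
  have /eqP : s ^+ 2 = 0 by rewrite cN sqrrN expr1n in cs; lra.
  by rewrite sqrf_eq0 => /eqP ->; ring.
exists c', (s / (2 * c')).
have s2 : (s / (2 * c')) ^+ 2 = (1 - c) / 2.
  have : c' ^+ 2 != 0 by rewrite sqrf_eq0.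
  rewrite exprMn exprVn exprMn c2 => h.
  have -> : s ^+ 2 = (1 - c) * (1 + c) by rewrite -[LHS](addrK (c ^+ 2)) (addrC (s ^+ 2)) cs; ring.
  by field; move: h; apply: contraNneq => h; rewrite mulf_eq0; apply/orP; left; apply/eqP; lra.
split; [by rewrite c2 s2; field|by rewrite c2 s2; field|by field].
Qed.

End plane_maps.

(** * Joint measurability of the maps *)

Section measurable_sphere_maps.
Context {R : realType} {d : nat}.
Notation S := (sphere R d).
Context d' (T : measurableType d').
Implicit Types (f g : T -> borel S) (c s : T -> R).
Hypothesis d_gt0 : (0 < d)%N.

Lemma measurable_coord_comp f i : measurable_fun [set: T] f ->
  measurable_fun [set: T] (fun t => coord i (f t)).
Proof. by move=> mf; exact: measurableT_comp (measurable_coord i) mf. Qed.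

Lemma measurable_dot f g : measurable_fun [set: T] f -> measurable_fun [set: T] g ->
  measurable_fun [set: T] (fun t => dot (f t : S) (g t : S)).
Proof.
move=> mf mg; rewrite (_ : (fun _ => _) =
    fun t => \sum_(i <- index_enum 'I_d.+1) coord i (f t) * coord i (g t)).
  by apply: measurable_sum => i; apply: measurable_funM; exact: measurable_coord_comp.
by apply/funext => t; exact: dotE.
Qed.

Lemma measurable_refl f g : measurable_fun [set: T] f -> measurable_fun [set: T] g ->
  measurable_fun [set: T] (fun t => refl (f t) (g t) : borel S).
Proof.
move=> mf mg; apply: measurable_to_sphere => i.
rewrite (_ : (fun _ => _) =
    fun t => coord i (g t) - 2 * dot (f t : S) (g t : S) * coord i (f t)).
  apply: measurable_funB; first exact: measurable_coord_comp.
  apply: measurable_funM; last exact: measurable_coord_comp.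
  by apply: measurable_funM; [exact: measurable_cst|exact: measurable_dot].
by apply/funext => t; rewrite {1}/coord reflE !mxE mulNr.
Qed.

Notation p := (coord (ord_max : 'I_d.+1)).
Notation q := (coord (ord0 : 'I_d.+1)).

Lemma measurable_replace f s c : measurable_fun [set: T] f ->
  measurable_fun [set: T] s -> measurable_fun [set: T] c ->
  (forall t, s t ^+ 2 + c t ^+ 2 = q (f t) ^+ 2 + p (f t) ^+ 2) ->
  measurable_fun [set: T] (fun t => replace (f t) (s t) (c t) : borel S).
Proof.
move=> mf ms mc sc; apply: measurable_to_sphere => i.
have [->|n0] := eqVneq i ord0.
  by rewrite (_ : (fun _ => _) = s)//; apply/funext => t; rewrite q_replace.
have [->|n1] := eqVneq i ord_max.
  by rewrite (_ : (fun _ => _) = c)//; apply/funext => t; rewrite p_replace.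
rewrite (_ : (fun _ => _) = fun t => coord i (f t)); first exact: measurable_coord_comp.
by apply/funext => t; rewrite rest_replace.
Qed.

Lemma measurable_fold f : measurable_fun [set: T] f ->
  measurable_fun [set: T] (fun t => fold (f t) : borel S).
Proof.
move=> mf; apply: measurable_replace => //.
- exact: measurableT_comp (@normr_measurable R setT) (measurable_coord_comp _ mf).
- exact: measurable_coord_comp.
- by move=> t; rewrite real_normK ?num_real.
Qed.

Lemma measurable_rot f c s : measurable_fun [set: T] f ->
  measurable_fun [set: T] c -> measurable_fun [set: T] s ->
  (forall t, c t ^+ 2 + s t ^+ 2 = 1) ->
  measurable_fun [set: T] (fun t => rot (c t) (s t) (f t) : borel S).
Proof.
move=> mf mc ms cs; have mp := measurable_coord_comp ord_max mf.
have mq := measurable_coord_comp ord0 mf; apply: measurable_replace => //.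
- by apply: measurable_funD; exact: measurable_funM.
- by apply: measurable_funB; exact: measurable_funM.
- move=> t; rewrite -[RHS]mul1r -(cs t); ring.
Qed.

Let measurable_rho f : measurable_fun [set: T] f ->
  measurable_fun [set: T] (fun t => rho (f t)).
Proof.
move=> mf; rewrite (_ : (fun _ => _) =
    fun t => (q (f t) ^+ 2 + p (f t) ^+ 2) `^ (2^-1)); last first.
  by apply/funext => t; rewrite powR12_sqrt// addr_ge0// sqr_ge0.
apply: (measurableT_comp (measurable_powR _)).
by apply: measurable_funD; apply: measurable_funX; exact: measurable_coord_comp.
Qed.

Let measurable_rhoV f : measurable_fun [set: T] f ->
  measurable_fun [set: T] (fun t => (rho (f t))^-1).
Proof.
move=> mf; rewrite (_ : (fun _ => _) = fun t => rho (f t) `^ (- 1)); last first.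
  by apply/funext => t; rewrite powR_inv1// rho_ge0.
exact: measurableT_comp (measurable_powR _) (measurable_rho mf).
Qed.

Lemma measurable_angc f : measurable_fun [set: T] f ->
  measurable_fun [set: T] (fun t => angc (f t)).
Proof.
move=> mf; apply: measurable_fun_ifT => //.
- by apply: measurable_fun_eqr; [exact: measurable_rho|exact: measurable_cst].
- by apply: measurable_funM; [exact: measurable_coord_comp|exact: measurable_rhoV].
Qed.

Lemma measurable_angs f : measurable_fun [set: T] f ->
  measurable_fun [set: T] (fun t => angs (f t)).
Proof.
by move=> mf; apply: measurable_funM; [exact: measurable_coord_comp|exact: measurable_rhoV].
Qed.

Lemma measurable_double f : measurable_fun [set: T] f ->
  measurable_fun [set: T] (fun t => double (f t) : borel S).
Proof.
move=> mf; apply: measurable_rot => //; first exact: measurable_angc.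
  exact: measurable_angs.
by move=> t; exact: ang_unit.
Qed.

End measurable_sphere_maps.

(** * Angle doubling preserves the uniform measure *)

Section uniform_double.
Context {R : realType} {d : nat}.
Notation S := (sphere R d).
Notation BS := (borel S).
Notation mu := (uniform_sphere R d).
Hypothesis d_gt0 : (0 < d)%N.

Notation p := (coord (ord_max : 'I_d.+1)).
Notation q := (coord (ord0 : 'I_d.+1)).

Lemma mean_preserving_refl v : mean_preserving mu (refl v : BS -> BS).
Proof.
apply: (@mean_preserving_isometry _ _ _ (refl v)); try exact: reflK.
  by apply: measurable_refl => //; exact: measurable_cst.
exact: dot_refl_isometry.
Qed.

Lemma mean_preserving_rot c s : c ^+ 2 + s ^+ 2 = 1 ->
  mean_preserving mu (rot c s : BS -> BS).
Proof.
move=> cs; apply: (@mean_preserving_isometry _ _ _ (rot c (- s))).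
- by apply: measurable_rot => //; exact: measurable_cst.
- exact: dot_rot.
- exact: rotK.
- by have csN : c ^+ 2 + (- s) ^+ 2 = 1; [rewrite sqrrN|rewrite -{2}(opprK s); exact: rotK].
Qed.

Let norm2 (w : BS) : R := q w ^+ 2 + p w ^+ 2.

Let bounded_coord i : bounded_measurable (coord i : BS -> R).
Proof.
split; first exact: measurable_coord.
exists 1 => x; rewrite -(@ler_pXn2r _ 2)// ?nnegrE// real_normK ?num_real// expr1n.
rewrite -(dot_sphere1 x) dotE (bigD1 i)//= -expr2 lerDl.
by apply: sumr_ge0 => j _; rewrite -expr2 sqr_ge0.
Qed.

Let bounded_norm2 : bounded_measurable norm2.
Proof. by apply: bounded_measurableD; exact: bounded_measurableX2. Qed.

(** Reflections exchange the basis vectors, so all coordinates have the same second moment, and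
    these moments add up to 1. *)
Let mean_norm2_gt0 : 0 < \int[mu]_w norm2 w.
Proof.
have qE i : \int[mu]_x coord i (x : S) ^+ 2 = \int[mu]_x q (x : S) ^+ 2.
  pose e j : S := to_sphere (delta_mx 0 j).
  have eE j (x : S) : dot (e j) x = coord j x.
    rewrite to_sphereK /dot (bigD1 j)//= !mxE !eqxx mul1r big1 ?addr0// => k /negbTE kj.
      by rewrite mxE eqxx kj mul0r.
    by rewrite mxE eqxx kj mul0r.
  have [v ve] := refl_transitive d_gt0 (e i) (e ord0).
  rewrite -((mean_preserving_refl v).2 (fun x : BS => q (x : S) ^+ 2)); last first.
    exact: bounded_measurableX2.
  apply: eq_Rintegral => x _.
  by rewrite -!eE -ve dot_refl_isometry.
have : \sum_(i < d.+1) \int[mu]_x coord i (x : S) ^+ 2 = 1.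
  pose g (s : seq 'I_d.+1) (x : BS) : R := \sum_(i <- s) coord i (x : S) ^+ 2.
  have sumE s : \sum_(i <- s) \int[mu]_x coord i (x : S) ^+ 2 = \int[mu]_x g s x /\
      bounded_measurable (g s).
    elim: s => [|i s [ih bs]].
      have -> : g [::] = fun=> 0 by apply/funext => x; rewrite /g big_nil.
      by rewrite big_nil mean_cst; split => //; exact: bounded_measurable_cst.
    have bi := bounded_measurableX2 (bounded_coord i).
    have -> : g (i :: s) = fun x => coord i (x : S) ^+ 2 + g s x.
      by apply/funext => x; rewrite /g big_cons.
    by rewrite big_cons ih meanD//; split => //; exact: bounded_measurableD.
  rewrite (sumE _).1 -[RHS](mean_cst mu); apply: eq_Rintegral => x _.
  by rewrite /g -(dot_sphere1 x) dotE; apply: eq_bigr => i _; rewrite expr2.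
under eq_bigr do rewrite qE; rewrite sumr_const card_ord -mulr_natl => q1.
have q0 : 0 < \int[mu]_x q (x : S) ^+ 2.
  by rewrite -(pmulr_rgt0 _ (ltr0Sn R d)) q1.
apply: (lt_le_trans q0); apply: le_mean => //; first exact: bounded_measurableX2.
by move=> x; rewrite /norm2 lerDl sqr_ge0.
Qed.

(* Averaging over the rotations by the angle of an independent point [w] shows
   that [double] preserves the measure. Points [w] projecting to 0 have no
   well-defined angle; the weight [norm2 w] discards them. *)
Lemma mean_preserving_double : mean_preserving mu (double : BS -> BS).
Proof.
have md : measurable_fun [set: BS] (double : BS -> BS).
  by apply: measurable_double => //; exact: measurable_id.
split => // F bF; have bFd := bounded_measurable_comp bF md.
have mrot (D : BS -> BS) : measurable_fun [set: BS] D ->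
    bounded_measurable (fun z : BS * BS =>
      norm2 z.2 * F (rot (angc z.2) (angs z.2) (D z.1))).
  move=> mD; apply: bounded_measurableM.
    exact: bounded_measurable_comp bounded_norm2 measurable_snd.
  apply: (bounded_measurable_comp bF); apply: measurable_rot => //.
  - exact: measurableT_comp mD measurable_fst.
  - by apply: measurable_angc; exact: measurable_snd.
  - by apply: measurable_angs; exact: measurable_snd.
  - by move=> z; exact: ang_unit.
have b1 := mrot _ md; have b2 := mrot _ (@measurable_id _ _ setT).
(* For fixed [w], rotating [double x] by the angle of [w] is doubling [x] rotated by half that
   angle, and rotations preserve the measure. *)
have e1 : \int[mu]_x \int[mu]_w (norm2 w * F (rot (angc w) (angs w) (double x))) =
    \int[mu]_w norm2 w * \int[mu]_x F (double x).
  rewrite (mean_fubini mu mu b1)/= mulrC -meanZ//; apply: eq_Rintegral => w _.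
  have [c [s [cs c2 s2]]] := half_angle (ang_unit w).
  rewrite meanZ; last first.
    apply: (bounded_measurable_comp bF); apply: measurable_rot => //.
    by move=> z; exact: ang_unit.
  rewrite mulrC; congr (_ * _).
  rewrite -((mean_preserving_rot cs).2 _ bFd); apply: eq_Rintegral => x _.
  by rewrite double_rot// c2 s2.
have e2 : \int[mu]_x \int[mu]_w (norm2 w * F (rot (angc w) (angs w) x)) =
    \int[mu]_w norm2 w * \int[mu]_x F x.
  rewrite (mean_fubini mu mu b2)/= mulrC -meanZ//; apply: eq_Rintegral => w _.
  rewrite meanZ; last exact: bounded_measurable_comp bF (mean_preserving_rot (ang_unit w)).1.
  by rewrite mulrC ((mean_preserving_rot (ang_unit w)).2 _ bF).
apply: (mulfI (lt0r_neq0 mean_norm2_gt0)); rewrite -e1 -e2.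
apply: eq_Rintegral => x _.
(* Replace [w] by its rotation by the angle of [x]: its angle grows by that of [x], so [x] is
   rotated once more by its own angle and becomes [double x]. *)
rewrite -((mean_preserving_rot (ang_unit x)).2 (fun w => norm2 w *
  F (rot (angc w) (angs w) x)) (bounded_measurable_xsection x b2)).
apply: eq_Rintegral => w _; rewrite /norm2 -!sqr_rho rho_rot ?ang_unit//.
have [->|w0] := eqVneq (rho (w : S)) 0; first by rewrite expr0n !mul0r.
rewrite angc_rot ?ang_unit// angs_rot ?ang_unit// rot_rot ?ang_unit//.
by congr (_ * F (rot _ _ _)); ring.
Qed.

End uniform_double.

(** * The pair of Lipschitz maps and its one-point estimates *)

Section doubling_pair.
Context {R : realType} {d : nat}.
Notation S := (sphere R d).
Notation BS := (borel S).
Notation mu := (uniform_sphere R d).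
Hypothesis d_gt0 : (0 < d)%N.

Let m_double : measurable_fun [set: BS] (double : BS -> BS).
Proof. by apply: measurable_double => //; exact: measurable_id. Qed.

Let m_fold_double : measurable_fun [set: BS] (fold_double : BS -> BS).
Proof.
apply: measurable_double => //; apply: measurable_fold => //; exact: measurable_id.
Qed.

Let mp_flip : mean_preserving mu (flip : BS -> BS).
Proof. exact: mean_preserving_refl. Qed.

Let mp_antipode : mean_preserving mu (antipode : BS -> BS).
Proof. by apply: mean_preserving_rot => //; rewrite sqrrN expr1n expr0n addr0. Qed.

(* Half of [f o fold_double] is [f o double], half is [f o flip o double]. *)
Lemma mean_fold_double (G : BS -> BS -> R) :
  bounded_measurable (fun x : BS => G (double x) (fold_double x)) ->
  bounded_measurable (fun x : BS => G x x) ->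
  bounded_measurable (fun x : BS => G x (flip x)) ->
  \int[mu]_x G (double x) (fold_double x) =
  2^-1 * \int[mu]_x (G x x + G x (flip x)).
Proof.
move=> b1 b2 b3.
have b1a := bounded_measurable_comp b1 mp_antipode.1.
(* Average over [x] and its half turn, of which exactly one yields the flipped value. *)
have E : \int[mu]_x G (double x) (fold_double x) =
    2^-1 * \int[mu]_x (G (double x) (fold_double x) +
      G (double (antipode x)) (fold_double (antipode x))).
  have ->// := meanD mu b1 b1a; have /= -> := mp_antipode.2 _ b1. by field.
rewrite E; congr (_ * _).
rewrite -((mean_preserving_double d_gt0).2 _ (bounded_measurableD b2 b3)).
apply: eq_Rintegral => x _; rewrite double_antipode//.
by have [[-> ->]|[-> ->]] := fold_double_pair d_gt0 x; rewrite // addrC.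
Qed.

Lemma mean_preserving_fold_double : mean_preserving mu (fold_double : BS -> BS).
Proof.
split => // f bf; have bff := bounded_measurable_comp bf mp_flip.1.
rewrite (@mean_fold_double (fun _ y => f y))//; last first.
  exact: bounded_measurable_comp bf m_fold_double.
by rewrite meanD// mp_flip.2//; field.
Qed.

(** By [mean_fold_double] the right side is half the mean of [u^2 + v^2] with [u = a - b] and
    [v = a - b o flip], and [u^2 + v^2 >= (v - u)^2 / 2] eliminates [a]. *)
Lemma one_particle_double (a b : BS -> R) :
  bounded_measurable a -> bounded_measurable b ->
  4^-1 * \int[mu]_x (b x - b (flip x)) ^+ 2 <=
  \int[mu]_x (a (double x) - b (fold_double x)) ^+ 2.
Proof.
move=> ba bb.
have bbf := bounded_measurable_comp bb mp_flip.1.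
have b1 : bounded_measurable (fun x : BS => (a (double x) - b (fold_double x)) ^+ 2).
  apply: bounded_measurableX2; apply: bounded_measurableB.
    exact: bounded_measurable_comp ba m_double.
  exact: bounded_measurable_comp bb m_fold_double.
have b2 := bounded_measurableX2 (bounded_measurableB ba bb).
have b3 := bounded_measurableX2 (bounded_measurableB ba bbf).
have b4 := bounded_measurableX2 (bounded_measurableB bb bbf).
rewrite (@mean_fold_double (fun x y => (a x - b y) ^+ 2))//.
rewrite (_ : 4^-1 = 2^-1 * 2^-1 :> R); last by field.
rewrite -mulrA ler_wpM2l ?invr_ge0// -meanZ//.
apply: le_mean => [||x].
- by apply: bounded_measurableM => //; exact: bounded_measurable_cst.
- exact: bounded_measurableD.
have := sqr_ge0 (a x - b x + (a x - b (flip x))).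
set u := a x - b x; set v := a x - b (flip x).
rewrite (_ : b x - b (flip x) = v - u); last by rewrite /u /v; ring.
have -> : 2^-1 * (v - u) ^+ 2 = u ^+ 2 + v ^+ 2 - 2^-1 * (u + v) ^+ 2 by field.
lra.
Qed.

(** [doubling], [fold_doubling] and [spinning] are the maps Phi, Psi and sigma, as functions of the
    pair of [v] and [x] so that joint measurability can be stated. *)
Definition doubling (z : BS * BS) : BS := refl z.1 (double (refl z.1 z.2)).
Definition fold_doubling (z : BS * BS) : BS := refl z.1 (fold_double (refl z.1 z.2)).
Definition spinning (z : BS * BS) : BS := refl (refl z.1 (point : S)) z.2.

Let m_refl : measurable_fun [set: BS * BS] (fun z => refl z.1 z.2 : BS).
Proof. exact: measurable_refl. Qed.

Lemma measurable_doubling : measurable_fun [set: BS * BS] doubling.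
Proof. by apply: measurable_refl => //; exact: measurableT_comp m_double m_refl. Qed.

Lemma measurable_fold_doubling : measurable_fun [set: BS * BS] fold_doubling.
Proof. by apply: measurable_refl => //; exact: measurableT_comp m_fold_double m_refl. Qed.

Lemma measurable_spinning : measurable_fun [set: BS * BS] spinning.
Proof.
apply: measurable_refl => //; apply: measurable_refl => //; exact: measurable_cst.
Qed.

Let mp_conj (f : BS -> BS) v : mean_preserving mu f ->
  mean_preserving mu (fun x => refl v (f (refl v x)) : BS).
Proof.
move=> [mf fP]; have [mr rP] := mean_preserving_refl (v : S).
have mrf := measurableT_comp mr mf.
split; first exact: measurableT_comp mrf mr.
move=> h bh; rewrite (rP (fun x => h (refl v (f x)))); last first.
  exact: bounded_measurable_comp bh mrf.
by rewrite (fP (fun x => h (refl v x))) ?rP//; exact: bounded_measurable_comp bh mr.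
Qed.

Lemma mean_preserving_doubling v : mean_preserving mu (fun x => doubling (v, x)).
Proof. exact/mp_conj/mean_preserving_double. Qed.

Lemma mean_preserving_fold_doubling v :
  mean_preserving mu (fun x => fold_doubling (v, x)).
Proof. exact/mp_conj/mean_preserving_fold_double. Qed.

(** Substituting [refl v x] for [x] reduces this to [one_particle_double] for [a] and [b] composed
    with [refl v]; by [refl_refl] the conjugate of [flip] is [spinning]. *)
Lemma one_particle_doubling (v : BS) (a b : BS -> R) :
  bounded_measurable a -> bounded_measurable b ->
  4^-1 * \int[mu]_x (b x - b (spinning (v, x))) ^+ 2 <=
  \int[mu]_x (a (doubling (v, x)) - b (fold_doubling (v, x))) ^+ 2.
Proof.
move=> ba bb; have [mr rP] := mean_preserving_refl (v : S).
have bar := bounded_measurable_comp ba mr; have bbr := bounded_measurable_comp bb mr.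
have bZ : bounded_measurable (fun x : BS =>
    (a (refl v (double x)) - b (refl v (fold_double x))) ^+ 2).
  apply: bounded_measurableX2; apply: bounded_measurableB.
    exact: bounded_measurable_comp bar m_double.
  exact: bounded_measurable_comp bbr m_fold_double.
have bs : bounded_measurable (fun x : BS => (b x - b (spinning (v, x))) ^+ 2).
  apply: bounded_measurableX2; apply: bounded_measurableB => //.
  apply: (bounded_measurable_comp bb).
  exact: measurableT_comp measurable_spinning (pair1_measurable _).
rewrite (rP _ bZ) -(rP _ bs).
apply: le_trans (one_particle_double bar bbr).
rewrite le_eqVlt; apply/orP; left; apply/eqP; congr (_ * _).
by apply: eq_Rintegral => x _; rewrite /spinning/= -refl_refl reflK.
Qed.

(* [v |-> spinning (v, x)] is Lipschitz and onto, hence the law of its value at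
   a random [v] dominates a multiple of the uniform measure. *)
Lemma spread_spinning (b : BS -> R) : bounded_measurable b ->
  2 * (16 ^+ d)^-1 * (\int[mu]_x b x ^+ 2 - (\int[mu]_x b x) ^+ 2) <=
  \int[mu]_v \int[mu]_x (b x - b (spinning (v, x))) ^+ 2.
Proof.
move=> bb; have b2 := bounded_measurableX2 bb.
have bcst (r : R) : bounded_measurable (fun _ : BS => r).
  exact: bounded_measurable_cst.
have bD : bounded_measurable (fun z : BS * BS => (b z.2 - b (spinning z)) ^+ 2).
  apply: bounded_measurableX2; apply: bounded_measurableB.
    exact: bounded_measurable_comp bb measurable_snd.
  exact: bounded_measurable_comp bb measurable_spinning.
rewrite (mean_fubini mu mu bD)/=.
have K0 : 0 < 16 ^+ d :> R by rewrite exprn_gt0.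
(* Two uses of [refl_lipschitz] give [8 * 8], hence [K = 8] for chords, which [dot_lipschitz]
   doubles. *)
have lip (x : S) (v w : S) : mdist (spinning (v, x)) (spinning (w, x)) <= 16 * mdist v w.
  rewrite (_ : 16 = 2 * 8 :> R); last by ring.
  apply: (@dot_lipschitz _ _ (fun v : S => spinning (v, x)) 8) => // {}v {}w.
  apply: (le_trans (refl_lipschitz _ _ _)).
  have := refl_lipschitz v w (point : S); lra.
have onto (x y : S) : exists v : S, spinning (v, x) = y.
  have [u <-] := refl_transitive d_gt0 x y.
  by have [v <-] := refl_transitive d_gt0 (point : S) u; exists v.
have dom x : (16 ^+ d)^-1 * \int[mu]_y (b x - b y) ^+ 2 <=
    \int[mu]_v (b x - b (spinning (v, x))) ^+ 2.
  rewrite ler_pdivrMl//.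
  apply: (le_mean_comp (ltW K0) (X := fun v => spinning (v, x))
    (f := fun y => (b x - b y) ^+ 2)).
  - exact: measurableT_comp measurable_spinning (pair2_measurable _).
  - by move=> A _; exact: uniform_sphere_lipschitz.
  - by apply: bounded_measurableX2; exact: bounded_measurableB.
  - by move=> y; exact: sqr_ge0.
(* Averaged over [x], this is twice the variance of [b]: the factor 2 in the statement. *)
have E x : \int[mu]_y (b x - b y) ^+ 2 =
    b x ^+ 2 + (\int[mu]_y b y ^+ 2 - 2 * \int[mu]_y b y * b x).
  transitivity (\int[mu]_y (b x ^+ 2 + (b y ^+ 2 - (2 * b x) * b y))).
    by apply: eq_Rintegral => y _; ring.
  have bM := bounded_measurableM (bcst (2 * b x)) bb.
  by rewrite meanD ?meanB ?meanZ ?mean_cst//; [ring|exact: bounded_measurableB].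
have bM := bounded_measurableM (bcst (2 * \int[mu]_y b y)) bb.
have bS := bounded_measurableD b2 (bounded_measurableB (bcst (\int[mu]_y b y ^+ 2)) bM).
apply: (@le_trans _ _ (\int[mu]_x ((16 ^+ d)^-1 * \int[mu]_y (b x - b y) ^+ 2))).
  under eq_Rintegral do rewrite E.
  rewrite meanZ// meanD//; last exact: bounded_measurableB.
  rewrite meanB// meanZ// mean_cst le_eqVlt; apply/orP; left; apply/eqP; ring.
apply: le_mean => //.
- apply: bounded_measurableM; first exact: bcst.
  by under eq_fun do rewrite E.
- exact: (bounded_measurable_mean1 mu bD).
Qed.

Let conj_lipschitz (f : S -> S) v :
  (forall x y, 1 - dot (f x) (f y) <= 2 ^+ 2 * (1 - dot x y)) ->
  forall x y, mdist (refl v (f (refl v x))) (refl v (f (refl v y))) <= 4 * mdist x y.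
Proof.
move=> fL x y; rewrite (_ : 4 = 2 * 2 :> R); last by ring.
apply: (@dot_lipschitz _ _ (fun x : S => refl v (f (refl v x))) 2) => // {}x {}y.
by rewrite dot_refl_isometry (le_trans (fL _ _))// dot_refl_isometry.
Qed.

Lemma doubling_lipschitz (v x y : S) :
  mdist (doubling (v, x) : S) (doubling (v, y)) <= 4 * mdist x y.
Proof. exact/conj_lipschitz/double_lipschitz. Qed.

Lemma fold_doubling_lipschitz (v x y : S) :
  mdist (fold_doubling (v, x) : S) (fold_doubling (v, y)) <= 4 * mdist x y.
Proof. exact/conj_lipschitz/fold_double_lipschitz. Qed.

End doubling_pair.

(** * Geometric graphs *)

Section graph_event.
Context {R : realType} {d : nat}.
Notation S := (sphere R d).
Notation BS := (borel S).
Notation mu := (uniform_sphere R d).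
Implicit Types (n : nat) (r : R).

Lemma mdist_le_cos (x y : S) r : 0 <= r <= pi ->
  (mdist x y <= r) = (cos r <= dot x y).
Proof.
by move=> r0; rewrite -cos_mdist !leNgt ltr_cos// in_itv/= ?mdist_itv.
Qed.

Lemma measurable_mdist_le d' (T : measurableType d') (f g : T -> BS) r :
  0 <= r -> measurable_fun [set: T] f -> measurable_fun [set: T] g ->
  measurable [set t | mdist (f t : S) (g t) <= r].
Proof.
move=> r0 mf mg; have [rpi|rpi] := leP r pi.
  rewrite (_ : [set t | _] =
      (fun t => dot (f t : S) (g t : S)) @^-1` `[cos r, +oo[%classic).
    rewrite -[X in measurable X]setTI; apply: (measurable_dot mf mg) => //.
  by apply/seteqP; split => t /=; rewrite in_itv/= andbT mdist_le_cos// ?r0.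
rewrite (_ : [set t | _] = setT)//; apply/seteqP; split => // t _ /=.
by rewrite (le_trans _ (ltW rpi))// (andP (mdist_itv _ _)).2.
Qed.

Definition graph_event n (F : graph_property n) r : set (n.-tuple BS) :=
  [set x | geometric_graph (x : n.-tuple S) r \in F].

(** A finite union over the graphs in [F] of finite intersections of conditions on single edges. *)
Lemma measurable_graph_event n (F : graph_property n) r : 0 <= r ->
  measurable (graph_event F r).
Proof.
move=> r0.
have mdE (e : edge n) :
    measurable [set x : n.-tuple BS | mdist (tnth x (val e).1 : S) (tnth x (val e).2) <= r].
  by apply: measurable_mdist_le => //; exact: measurable_tnth.
rewrite (_ : graph_event F r = \bigcup_(G in [set G : graph n | G \in F])
    \bigcap_(e in [set: edge n]) [set x : n.-tuple BS |
      (mdist (tnth x (val e).1 : S) (tnth x (val e).2) <= r) = (e \in G)]).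
  apply: fin_bigcup_measurable => // G _; apply: fin_bigcap_measurable.
    exact: (@finite_finset {e : 'I_n * 'I_n | (e.1 < e.2)%N}).
  move=> e _; case: (e \in G); first exact: mdE.
  rewrite (_ : mkset _ = ~` [set x : n.-tuple BS |
    mdist (tnth x (val e).1 : S) (tnth x (val e).2) <= r]); first exact: measurableC.
  by apply/seteqP; split => x /= => [->//|/negP/negbTE].
apply/seteqP; split => [x xF|x [G /= GF xG]].
  by exists (geometric_graph (x : n.-tuple S) r) => // e _ /=; rewrite inE.
rewrite /graph_event /= (_ : geometric_graph _ _ = G)//.
by apply/setP => e; rewrite inE; exact: xG.
Qed.

Definition graph_prob n (F : graph_property n) r : R :=
  \int[power_prob mu n]_x (\1_(graph_event F r) x : R).

Lemma rgg_probE n (F : graph_property n) r : 0 <= r ->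
  rgg_prob mu r F = (graph_prob F r)%:E.
Proof.
move=> r0; rewrite /graph_prob mean_indic; last exact: measurable_graph_event.
by rewrite fineK// fin_num_measure//; exact: measurable_graph_event.
Qed.

Variables (n : nat) (F : graph_property n).
Hypothesis F_mono : monotone_property F.
Hypothesis d_gt0 : (0 < d)%N.

Notation f := (graph_prob F).
Notation A := (graph_event F).
Notation P := (power_prob mu n).

Lemma geometric_graph_image (g : S -> S) (K : R) (x : n.-tuple S) r :
  (forall y z, mdist (g y) (g z) <= K * mdist y z) -> 0 <= K ->
  geometric_graph x r \subset geometric_graph (map_tuple g x) (K * r).
Proof.
move=> gK K0; apply/fintype.subsetP => e; rewrite !inE !tnth_map => er.
by rewrite (le_trans (gK _ _))// ler_wpM2l.
Qed.

Lemma le_graph_event r r' : r <= r' -> A r `<=` A r'.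
Proof.
move=> rr' x; apply: F_mono; apply/fintype.subsetP => e; rewrite !inE => er.
exact: le_trans er rr'.
Qed.

Let bA r : 0 <= r -> bounded_measurable (\1_(A r) : n.-tuple BS -> R).
Proof.
by move=> r0; apply: bounded_measurable_indic; exact: measurable_graph_event.
Qed.

Lemma graph_prob_ge0 r : 0 <= f r.
Proof. by apply: mean_ge0 => x; rewrite indicE. Qed.

Lemma graph_prob_le1 r : 0 <= r -> f r <= 1.
Proof.
move=> r0; rewrite -[leRHS](mean_cst P); apply: le_mean; first exact: bA.
  exact: bounded_measurable_cst.
by move=> x; rewrite indicE lern1; case: (_ \in _).
Qed.

Lemma le_graph_prob r r' : 0 <= r -> r <= r' -> f r <= f r'.
Proof.
move=> r0 rr'; apply: le_mean; [exact: bA|exact/bA/(le_trans r0)|move=> x].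
rewrite !indicE ler_nat; case: (boolP (x \in A r)) => //; rewrite inE => xA.
by rewrite mem_set//; exact: le_graph_event rr' _ xA.
Qed.

(** Product of the constants of [one_particle_doubling] and [spread_spinning]. *)
Definition gain : R := 4^-1 * (2 * (16 ^+ d)^-1).

(** [tensor_spread] for the indicator [h] at radius [4 r], whose variance is [p (1 - p)] with
    [p = f (4 * r)], against the upper bound of [mean_sqrB_le], available because both maps send the
    event at radius [r] into the one at radius [4 r]. *)
Theorem graph_prob_improve r : 0 <= r ->
  f r <= f (4 * r) - gain / 2 * (f (4 * r) * (1 - f (4 * r))).
Proof.
move=> r0; have r40 : 0 <= 4 * r by rewrite mulr_ge0.
pose h : n.-tuple BS -> R := \1_(A (4 * r)).
have bh : bounded_measurable h by exact: bA.
have h2 x : h x ^+ 2 = h x by rewrite /h indicE; case: (_ \in _); rewrite ?expr1n ?expr0n.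
have h01 x : h x = 0 \/ h x = 1 by rewrite /h indicE; case: (_ \in _); [right|left].
have q0 : 0 <= 4^-1 :> R by rewrite invr_ge0.
have := @tensor_spread _ BS R mu _ BS mu (@doubling R d) (@fold_doubling R d)
  (@spinning R d) 4^-1 (2 * (16 ^+ d)^-1) (measurable_doubling d_gt0)
  (measurable_fold_doubling d_gt0) (measurable_spinning)
  (mean_preserving_doubling d_gt0) (mean_preserving_fold_doubling d_gt0) q0
  (one_particle_doubling d_gt0) (spread_spinning d_gt0) n h bh.
under [X in X - _]eq_Rintegral do rewrite h2.
rewrite -/gain -[\int[_]_x h x]/(f (4 * r)) => spread.
suff : \int[mu]_v \int[P]_x (h (map_tuple (fun y => doubling (v, y)) x) -
    h (map_tuple (fun y => fold_doubling (v, y)) x)) ^+ 2 <= 2 * (f (4 * r) - f r).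
  move=> /(le_trans spread); rewrite expr2; lra.
have mean_map (g : BS -> BS) : mean_preserving mu g ->
    bounded_measurable (fun x : n.-tuple BS => h (map_tuple g x)) /\
    \int[P]_x h (map_tuple g x) = f (4 * r).
  move=> mg; split; last exact: mean_preserving_tuple.
  exact: bounded_measurable_comp bh (measurable_map_tuple1 mg.1).
have lip (g : S -> S) x : (forall y z, mdist (g y) (g z) <= 4 * mdist y z) ->
    A r x -> h (map_tuple g x) = 1.
  move=> gL xA; rewrite /h indicE mem_set//.
  by apply: (F_mono _ xA); exact: geometric_graph_image.
pose w : n.-tuple BS -> R := \1_(A r).
have bw : bounded_measurable w by exact: bA.
have wE : \int[P]_x w x = f r by [].
have w1 x : A r x -> w x = 1 by move=> xA; rewrite /w indicE mem_set.
have w0 x : ~ A r x -> w x = 0 by move=> xA; rewrite /w indicE memNset.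
clearbody w; clearbody h.
have pair (g g' : BS -> BS) : mean_preserving mu g -> mean_preserving mu g' ->
    (forall y z : S, mdist (g y : S) (g z) <= 4 * mdist y z) ->
    (forall y z : S, mdist (g' y : S) (g' z) <= 4 * mdist y z) ->
    \int[P]_x (h (map_tuple g x) - h (map_tuple g' x)) ^+ 2 <= 2 * (f (4 * r) - f r).
  move=> /mean_map[b1 e1] /mean_map[b2 e2] gL gL'.
  apply: (mean_sqrB_le b1 b2 bw e1 e2 wE) => x.
  (* On the event both values of [h] are 1. Off it [w] vanishes, and [(a - b) ^+ 2 <= a + b] for
     numbers in {0, 1}. *)
  have [xA|xA] := pselect (A r x).
    rewrite (lip g x gL xA) (lip g' x gL' xA) (w1 x xA).
    by rewrite subrr expr0n mulr1 subrr.
  rewrite (w0 x xA) mulr0 subr0.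
  move: (h _) (h _) (h01 (map_tuple g x)) (h01 (map_tuple g' x)) => a b a01 b01.
  by case: a01 => ->; case: b01 => ->;
    rewrite ?(subrr, subr0, sub0r, sqrrN, expr1n, expr0n, addr0, add0r)//= addr_ge0.
have pt v := pair _ _ (mean_preserving_doubling d_gt0 v)
  (mean_preserving_fold_doubling d_gt0 v) (doubling_lipschitz d_gt0 v)
  (fold_doubling_lipschitz d_gt0 v).
have -> : 2 * (f (4 * r) - f r) = \int[mu]_(_ in [set: BS]) (2 * (f (4 * r) - f r)).
  by rewrite mean_cst.
apply: le_mean => //; last exact: bounded_measurable_cst.
have m1 : measurable_fun [set: BS * n.-tuple BS]
    (fun z => map_tuple (fun y => doubling (z.1, y)) z.2).
  exact: measurable_map_tuple (measurable_doubling d_gt0).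
have m2 : measurable_fun [set: BS * n.-tuple BS]
    (fun z => map_tuple (fun y => fold_doubling (z.1, y)) z.2).
  exact: measurable_map_tuple (measurable_fold_doubling d_gt0).
exact: (bounded_measurable_mean2 P (bounded_measurableX2 (bounded_measurableB
  (bounded_measurable_comp bh m1) (bounded_measurable_comp bh m2)))).
Qed.

End graph_event.

(** * From the improvement inequality to thresholds *)

Section thresholds.
Context {R : realType} {d : nat}.
Notation S := (sphere R d).
Notation BS := (borel S).
Notation mu := (uniform_sphere R d).
Notation f F := (@graph_prob R d _ F).
Hypothesis d_gt0 : (0 < d)%N.
Implicit Types (n : nat) (r : R).

Lemma measurable_sphere_set1 (x : BS) : measurable [set x].
Proof.
rewrite (_ : [set x] = [set y : BS | mdist (y : S) x <= 0]).
  by apply: measurable_mdist_le.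
apply/seteqP; split => [y -> /=|y /= xy]; first by rewrite mdistxx.
by apply: mdist_positivity; apply/eqP; rewrite eq_le xy (andP (mdist_itv _ _)).1.
Qed.

Lemma uniform_sphere_tuple n (t : n.-tuple BS) (A : set BS) :
  measurable A -> A `<=` [set` t] -> mu A = 0%E.
Proof.
move=> mA At; apply: measure_negligible => //.
apply: (@negligibleS _ _ _ _ (\bigcup_k [set nth point t k])).
  by move=> x /At /= /(nthP point)[k _ <-]; exists k.
apply: negligible_bigcup => k; apply/negligibleP; first exact: measurable_sphere_set1.
exact: uniform_sphere_set1.
Qed.

Lemma collision_cons n x (t : n.-tuple BS) :
  geometric_graph (tuple_cons (x, t) : n.+1.-tuple S) 0 != finset.set0 ->
  geometric_graph (t : n.-tuple S) 0 != finset.set0 \/ x \in (t : seq BS).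
Proof.
move=> /finset.set0Pn[[[i j] /= ij]]; rewrite !inE /= !(tnth_nth point) /=.
case: i ij => -[|i] ilt; case: j => -[|j] jlt //= ij xy.
  right; have -> : x = nth point t j.
    by apply: mdist_positivity; apply/eqP; rewrite eq_le xy (andP (mdist_itv _ _)).1.
  by rewrite mem_nth// size_tuple.
left; apply/finset.set0Pn.
exists (exist (fun e : 'I_n * 'I_n => (e.1 < e.2)%N)
  (Ordinal (ilt : (i < n)%N), Ordinal (jlt : (j < n)%N)) ij).
by rewrite !inE !(tnth_nth point).
Qed.

(** Edges at radius 0 are coincidences of points. If the last [n] points show none, a coincidence
    forces the first point into their finite set, which is null as [d > 0]. *)
Lemma graph_prob_collision n : f [set~ finset.set0 : graph n]%SET 0 = 0.
Proof.
elim: n => [|n ih].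
  rewrite /graph_prob -[RHS](mean_cst (power_prob mu 0)); apply: eq_Rintegral => x _.
  rewrite indicE memNset// /graph_event /= !inE => /negP; apply.
  by apply/eqP/setP => -[[[]]].
apply/eqP; rewrite eq_le graph_prob_ge0 andbT -[leRHS]ih.
have bE m : bounded_measurable
    (\1_(graph_event [set~ finset.set0 : graph m]%SET 0) : m.-tuple BS -> R).
  by apply: bounded_measurable_indic; exact: measurable_graph_event.
rewrite /graph_prob mean_power_prob//.
have bc := bounded_measurable_comp (bE n.+1) (@measurable_tuple_cons _ BS n).
apply: le_mean => [||t]; [exact: (bounded_measurable_mean1 mu bc)|exact: bE|].
have mt : measurable ((fun x : BS => tuple_cons (x, t)) @^-1`
    graph_event [set~ finset.set0 : graph n.+1]%SET 0).
  rewrite -[X in measurable X]setTI.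
  have mx : measurable_fun [set: BS] (fun x : BS => tuple_cons (x, t)).
    exact: measurableT_comp (@measurable_tuple_cons _ BS n) (pair2_measurable t).
  by apply: mx => //; exact: measurable_graph_event.
have [tE|tE] := pselect (graph_event [set~ finset.set0 : graph n]%SET 0 t).
  rewrite [leRHS]indicE mem_set// -[leRHS](mean_cst mu); apply: le_mean.
  - exact: (bounded_measurable_ysection _ bc).
  - exact: bounded_measurable_cst.
  - by move=> x; rewrite indicE lern1; case: (_ \in _).
rewrite [leRHS]indicE memNset// (_ : Rintegral _ _ _ = fine (mu
  ((fun x : BS => tuple_cons (x, t)) @^-1`
    graph_event [set~ finset.set0 : graph n.+1]%SET 0))).
  rewrite (@uniform_sphere_tuple _ t)// => x /=.
  rewrite /graph_event /= !inE => /collision_cons[tn|//].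
  by exfalso; apply: tE; rewrite /graph_event /= !inE.
by rewrite -mean_indic.
Qed.

Section one_property.
Variables (n : nat) (F : graph_property n).
Hypotheses (F_mono : monotone_property F) (F_nontriv : nontrivial_property F).

(** Distances are at most [pi <= 4], so the graph at radius 4 is complete. *)
Lemma graph_prob4 : f F 4 = 1.
Proof.
rewrite /graph_prob -[RHS](mean_cst (power_prob mu n)); apply: eq_Rintegral => x _.
rewrite indicE mem_set// /graph_event /=.
have /finset.set0Pn[G GF] := F_nontriv.1; apply: (F_mono _ GF).
apply/fintype.subsetP => e _; rewrite inE (le_trans (andP (mdist_itv _ _)).2)//.
have [/andP[_ +] _] := pihalf_02_cos_pihalf R; lra.
Qed.

Lemma set0_notin_property : finset.set0 \notin F.
Proof.
apply: contra F_nontriv.2 => F0; apply/eqP/setP => G; rewrite inE.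
by apply: F_mono F0; exact: finset.sub0set.
Qed.

(* Almost surely no two points coincide, and then the graph is empty for small r. *)
Lemma graph_prob_cvg0 (u : R^nat) : (forall k, 0 < u k) ->
  {homo u : k l / (k <= l)%N >-> l <= k} -> u k @[k --> \oo] --> 0 ->
  f F (u k) @[k --> \oo] --> 0.
Proof.
move=> u0 u_noninc ucvg; pose A k : set (n.-tuple BS) := graph_event F (u k).
have mA k : measurable (A k) by apply: measurable_graph_event; exact: ltW.
have Acap : \bigcap_k A k `<=` graph_event [set~ finset.set0 : graph n]%SET 0.
  move=> x xA; rewrite /graph_event /= !inE; apply/eqP => x0.
  have /filter_ex[k xk] : \forall k \near \oo, forall e : edge n,
      u k < mdist (tnth x (val e).1 : S) (tnth x (val e).2).
    apply: filter_forall => e; apply: cvgr_lt ucvg _ _.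
    rewrite ltNge; apply/negP => e0.
    have : e \in geometric_graph (x : n.-tuple S) 0 by rewrite inE.
    by rewrite x0 inE.
  have := xA k I; rewrite /A /graph_event /= (_ : geometric_graph _ _ = finset.set0).
    by rewrite (negbTE set0_notin_property).
  by apply/setP => e; rewrite !inE leNgt xk.
have P0 : power_prob mu n (\bigcap_k A k) = 0%E.
  have mE := measurable_graph_event (d := d) [set~ finset.set0 : graph n]%SET (lexx (0 : R)).
  apply: (subset_measure0 _ mE Acap); first exact: bigcap_measurableType.
  have := rgg_probE (d := d) [set~ finset.set0 : graph n]%SET (lexx 0 : 0 <= 0 :> R).
  by rewrite graph_prob_collision.
have /fine_cvgP[_] : power_prob mu n (A k) @[k --> \oo] --> (0 : R)%:E.
  rewrite -[X in _ --> X]P0; apply: nonincreasing_cvg_mu => //; first by rewrite ltey_eq fin_num_measure.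
    exact: bigcap_measurableType.
  by move=> k l kl; apply/subsetPset; apply: le_graph_event => //; exact: u_noninc.
rewrite (_ : _ \o _ = fun k => f F (u k))//.
by apply/funext => k /=; rewrite -mean_indic.
Qed.

(** One constant for both directions. Where [f <= 1/2] a step down gains a factor [1 - gain / 4];
    where [f >= 1/2] a step up divides [1 - f] by at least [1 + gain / 4], and
    [rate * (1 + gain / 4) >= 1]. *)
Definition rate : R := 1 - @gain R d / 8.

Lemma gain_itv : 0 < @gain R d <= 2^-1.
Proof.
have d1 : 1 <= 16 ^+ d :> R by rewrite exprn_ege1// ler1n.
have i0 : 0 < (16 ^+ d)^-1 :> R by rewrite invr_gt0 (lt_le_trans _ d1).
have i1 : (16 ^+ d)^-1 <= 1 :> R by rewrite invf_le1// (lt_le_trans _ d1).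
apply/andP; split; rewrite /gain; lra.
Qed.

Lemma rate_itv : 0 <= rate < 1.
Proof. by have /andP[g0 g1] := gain_itv; apply/andP; split; rewrite /rate; lra. Qed.

Lemma graph_prob_decay r k : 0 <= r -> f F (4 ^+ k * r) <= 2^-1 ->
  f F r <= rate ^+ k.
Proof.
have /andP[g0 g1] := gain_itv; have /andP[rate0 rate1] := rate_itv.
(* The factor 1/2 makes the induction hypothesis keep [f (4 * r)] at most 1/2, where the improvement
   is linear in [f]. *)
move=> r0; suff h : f F (4 ^+ k * r) <= 2^-1 -> f F r <= 2^-1 * rate ^+ k.
  move=> /h /le_trans; apply; rewrite ler_piMl ?exprn_ge0//; lra.
elim: k r r0 => [|k ih] r r0; first by rewrite expr0 mul1r mulr1.
have r40 : 0 <= 4 * r by rewrite mulr_ge0.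
rewrite exprSr -mulrA => /(ih _ r40) p_le.
have := graph_prob_improve F_mono d_gt0 r0.
have p0 := graph_prob_ge0 (d := d) F (4 * r).
have rk1 : rate ^+ k <= 1 by rewrite exprn_ile1// ltW.
have rk0 : 0 <= rate ^+ k by rewrite exprn_ge0.
move: p_le p0; move: (f F (4 * r)) (f F r) => p q p_le p0 q_le.
apply: (le_trans q_le); apply: (@le_trans _ _ (p * rate)).
  have p1 : 0 <= 2^-1 - p by rewrite subr_ge0; lra.
  have := mulr_ge0 (mulr_ge0 (ltW g0) p0) p1; have := mulr_ge0 (ltW g0) p0.
  rewrite /rate; move: (@gain R d) => g; nra.
by rewrite exprSr mulrA ler_wpM2r.
Qed.

Lemma graph_prob_growth r k : 0 <= r -> 2^-1 <= f F r ->
  1 - f F (4 ^+ k * r) <= rate ^+ k.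
Proof.
have /andP[g0 g1] := gain_itv; have /andP[rate0 rate1] := rate_itv.
move=> r0 fr; have fr4 k' : 2^-1 <= f F (4 ^+ k' * r).
  by apply: (le_trans fr); apply: le_graph_prob => //; rewrite ler_peMl// exprn_ege1// ler1n.
elim: k => [|k ih]; first by rewrite expr0 mul1r; lra.
have rk0 : 0 <= 4 ^+ k * r by rewrite mulr_ge0// exprn_ge0.
have := graph_prob_improve F_mono d_gt0 rk0; rewrite mulrA -exprS.
have := fr4 k.+1.
have : f F (4 ^+ k.+1 * r) <= 1 by apply: graph_prob_le1; rewrite mulr_ge0// exprn_ge0.
move: ih; move: (f F (4 ^+ k.+1 * r)) (f F (4 ^+ k * r)) => p q q_le p1 p2 q_ge.
rewrite exprS; apply: (@le_trans _ _ (rate * (1 - q))); last by rewrite ler_wpM2l.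
have q1 : 0 <= 1 - p by rewrite subr_ge0.
have q2 : 0 <= p - 2^-1 by rewrite subr_ge0.
have q3 : (1 - p) * (1 + @gain R d / 4) <= 1 - q.
  have := mulr_ge0 (mulr_ge0 (ltW g0) q1) q2; lra.
apply: le_trans (ler_wpM2l rate0 q3).
have g2 : 0 <= 4 - @gain R d by lra.
have := mulr_ge0 (mulr_ge0 q1 (ltW g0)) g2.
rewrite /rate; lra.
Qed.

(** Along the radii [4 / 4 ^ k] the probability tends to 0; [r] is the first at which it is at most
    1/2, so at [4 * r] it is still at least 1/2. Decay starts from [r] and growth from [4 * r]. *)
Theorem sharp_radius : exists2 r, 0 < r & forall s k, 0 <= s ->
  (4 ^+ k * s <= r -> f F s <= rate ^+ k) /\
  (4 ^+ k * (4 * r) <= s -> 1 - f F s <= rate ^+ k).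
Proof.
pose u k : R := 4 * (4^-1) ^+ k.
have q0 : 0 < 4^-1 :> R by rewrite invr_gt0.
have u0 k : 0 < u k by rewrite mulr_gt0// exprn_gt0.
have ucvg : u k @[k --> \oo] --> 0.
  rewrite -(mulr0 4); apply: cvgMl_tmp; apply: cvg_expr.
  by rewrite gtr0_norm// invf_lt1// ltr1n.
have umono : {homo u : k l / (k <= l)%N >-> l <= k}.
  by move=> k l kl; rewrite ler_wpM2l// ler_wiXn2l// ltW// invf_lt1// ltr1n.
have /filter_ex/ex_minnP[] : \forall k \near \oo, f F (u k) <= 2^-1.
  have := graph_prob_cvg0 u0 umono ucvg; move/cvgr_le; apply.
  by rewrite invr_gt0.
(* Index 0 is excluded since the probability at radius 4 is 1; hence the radius [u m] exists. *)
case=> [|m]; first by rewrite /u expr0 mulr1 graph_prob4; lra.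
move=> um least; exists (u m.+1) => // s k s0.
have um4 : 4 * u m.+1 = u m by rewrite /u exprS [4 * (4^-1 * _)]mulrA divff// mul1r.
split => [ks|ks].
  apply: graph_prob_decay => //; apply: le_trans um; apply: le_graph_prob => //.
  by rewrite mulr_ge0// exprn_ge0.
have fum : 2^-1 <= f F (u m).
  by rewrite leNgt; apply/negP => /ltW/least; rewrite ltnn.
apply: le_trans (graph_prob_growth k (ltW (u0 m)) fum); rewrite lerD2l lerN2 -um4.
by apply: le_graph_prob => //; rewrite !mulr_ge0// ?exprn_ge0// ltW.
Qed.

End one_property.
End thresholds.

Theorem theorem1p3 (R : realType) (d : nat) (hd : (1 <= d)%N) :
  admits_thresholds (uniform_sphere R d).
Proof.
move=> F F_mono_nontriv.
pose good n r := forall s k, 0 <= s ->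
  (4 ^+ k * s <= r -> @graph_prob R d n (F n) s <= @rate R d ^+ k) /\
  (4 ^+ k * (4 * r) <= s -> 1 - @graph_prob R d n (F n) s <= @rate R d ^+ k).
have /choice[r rP] n : exists r : R, 0 < r /\ ((2 <= n)%N -> good n r).
  (* For [n < 2] the radius only has to be positive; the limits ignore these [n]. *)
  have [n2|n2] := leqP 2 n; last by exists 1; split => //; rewrite leqNgt n2.
  have [Fm Fn] := F_mono_nontriv n n2.
  by case: (@sharp_radius R d hd n (F n) Fm Fn) => r r0 rP; exists r.
have /andP[rate0 rate1] := @rate_itv R d.
have small e : 0 < e -> exists k, @rate R d ^+ k < e.
  move=> e0; have rc : `|@rate R d| < 1 by rewrite ger0_norm.
  have /filter_ex : \forall k \near \oo, @rate R d ^+ k < e; last by [].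
  exact: cvgr_lt (cvg_expr rc) _ e0.
exists r; split => [n|s s0]; first exact: (rP n).1.
have rgg : (fun n => rgg_prob (uniform_sphere R d) (s n) (F n)) =
    EFin \o (fun n => @graph_prob R d n (F n) (s n)).
  by apply/funext => n /=; rewrite rgg_probE.
rewrite rgg; split => sr; apply: cvg_EFin; try exact: nearW.
(* [rate] does not depend on [n], so a single [k] with [rate ^+ k < e] serves all large [n]:
   eventually [s n / r n] is at most [4 ^- k], and in the other case above [4 ^+ k * 4]. *)
- apply/cvgrPdist_lt => e /small[k ke]; near=> n.
  have n2 : (2 <= n)%N by near: n; exact: nbhs_infty_ge.
  have [r0 /(_ n2 (s n) k (s0 n))[h _]] := rP n.
  rewrite /= sub0r normrN ger0_norm ?graph_prob_ge0// (le_lt_trans _ ke)// h//.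
  rewrite mulrC -ler_pdivlMr ?exprn_gt0// mulrC -ler_pdivrMr//.
  near: n; apply: cvgr_le sr _ _; by rewrite invr_gt0 exprn_gt0.
- apply/cvgrPdist_lt => e /small[k ke]; near=> n.
  have n2 : (2 <= n)%N by near: n; exact: nbhs_infty_ge.
  have [r0 /(_ n2 (s n) k (s0 n))[_ h]] := rP n.
  rewrite /= ger0_norm ?subr_ge0 ?graph_prob_le1// (le_lt_trans _ ke)// h//.
  rewrite mulrA -ler_pdivlMr//; apply/ltW.
  by near: n; move/cvgryPgt : sr; exact.
Unshelve. all: end_near.
Qed.
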